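(* Let $n\geq 2$ be an integer and let $X\subset\mathbf{S}^n$ be a finite set which contains no pair of antipodal points (i.e. there is no $x\in X$ with $-x\in X$). Then there exist a nonempty closed oriented smooth $n$-manifold $N$ and a smooth ($C^\infty$) immersion $F\colon N\to\mathbf{R}^{n+1}$ whose Gauss map $G_F\colon N\to\mathbf{S}^n$ misses $X$, i.e. $G_F(N)\cap X=\emptyset$.
   Context: A closed manifold is a compact manifold without boundary. For an immersion $F\colon N\to\mathbf{R}^{n+1}$ of an oriented $n$-manifold $N$, the Gauss map $G_F\colon N\to\mathbf{S}^n$ is the continuous unit normal vector field of $F$ determined by the orientation, so $G_F(x)\perp dF(T_xN)$ for all $x\in N$. *)

(* Defs.v *)
From mathcomp Require Import all_boot all_order all_algebra.
From mathcomp Require Import all_classical all_reals all_analysis.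

Set Implicit Arguments.
Unset Strict Implicit.
Unset Printing Implicit Defensive.

Import Order.TTheory GRing.Theory Num.Theory.
Import numFieldNormedType.Exports.

Local Open Scope classical_set_scope.
Local Open Scope ring_scope.

(* The norm that the library puts on row vectors is the sup norm. It induces  *)
(* the usual topology and the usual notion of differentiability, but lengths  *)
(* and right angles must be expressed through this inner product.             *)
Definition dotv (R : realType) (m : nat) (u v : 'rV[R]_m) : R :=
  \sum_(i < m) u 0 i * v 0 i.

(* S^n, as a subset of R^{n+1} *)
Definition sphere (R : realType) (n : nat) : set 'rV[R]_n.+1 :=
  [set u | dotv u u = 1].
Arguments sphere : clear implicits.

(* f is of class C^k on the open set U. In finite dimension the differential  *)
(* 'd f is C^k as an operator-valued map iff x |-> 'd f x v is C^k for all v. *)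
Fixpoint Ck_on (R : realType) (m p : nat) (k : nat)
    (U : set 'rV[R]_m) (f : 'rV[R]_m -> 'rV[R]_p) : Prop :=
  if k is k'.+1 then
    (forall x, U x -> differentiable f x) /\
    (forall v, Ck_on k' U (fun x => 'd f x v))
  else {within U, continuous f}.

Definition smooth_on (R : realType) (m p : nat)
    (U : set 'rV[R]_m) (f : 'rV[R]_m -> 'rV[R]_p) : Prop :=
  forall k : nat, Ck_on k U f.

(* A homeomorphism from an open subset of T onto an open subset of R^n. Only  *)
(* the values of [cmap] on [cdom] and of [cinv] on [cmap @` cdom] matter.     *)
Record chart (R : realType) (n : nat) (T : topologicalType) := Chart {
  cdom : set T;
  cmap : T -> 'rV[R]_n;
  cinv : 'rV[R]_n -> T;
  cdom_open : open cdom;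
  cimg_open : open (cmap @` cdom);
  cmapK : forall x, cdom x -> cinv (cmap x) = x;
  cmap_continuous : {within cdom, continuous cmap};
  cinv_continuous : {within cmap @` cdom, continuous cinv}
}.

(* An oriented smooth n-manifold without boundary. The smooth structure and   *)
(* the orientation are those given by an atlas, not required to be maximal,   *)
(* whose changes of coordinates are smooth with positive Jacobian             *)
(* determinant; the charts of the atlas are the positively oriented ones.     *)
Record orientedManifold (R : realType) (n : nat) := OrientedManifold {
  mcarrier :> topologicalType;
  atlas : set (chart R n mcarrier);
  m_hausdorff : hausdorff_space mcarrier;
  m_second_countable : @second_countable mcarrier;
  atlas_cover : forall x : mcarrier, exists2 c, atlas c & cdom c x;
  atlas_smooth : forall c d, atlas c -> atlas d ->
    smooth_on (cmap c @` (cdom c `&` cdom d)) (cmap d \o cinv c);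
  atlas_oriented : forall c d, atlas c -> atlas d ->
    forall x, (cdom c `&` cdom d) x ->
      0 < \det ('J (cmap d \o cinv c) (cmap c x))
}.

Definition smooth_map (R : realType) (n p : nat) (N : orientedManifold R n)
    (F : N -> 'rV[R]_p) : Prop :=
  forall c, atlas c -> smooth_on (cmap c @` cdom c) (F \o cinv c).

Definition immersion (R : realType) (n p : nat) (N : orientedManifold R n)
    (F : N -> 'rV[R]_p) : Prop :=
  smooth_map F /\
  (forall c, atlas c -> forall x, cdom c x ->
     injective ('d (F \o cinv c) (cmap c x))).

(* G is the Gauss map of the immersion F. The rows of 'J (F \o cinv c) are    *)
(* the images under dF of the coordinate vector fields of c, so the sign of G *)
(* is fixed by asking that the basis (G x, dF e_1, ..., dF e_n) of R^{n+1} be *)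
(* positively oriented whenever (e_1, ..., e_n) is.                           *)
Definition is_gauss_map (R : realType) (n : nat) (N : orientedManifold R n)
    (F G : N -> 'rV[R]_n.+1) : Prop :=
  [/\ continuous G,
      forall x, sphere R n (G x),
      forall c, atlas c -> forall x, cdom c x ->
        forall v, dotv (G x) ('d (F \o cinv c) (cmap c x) v) = 0 &
      forall c, atlas c -> forall x, cdom c x ->
        0 < \det (col_mx (G x) ('J (F \o cinv c) (cmap c x)) : 'M[R]_n.+1)].

(* Main.v *)
(* The manifold is the torus T = R^n / (2 pi Z)^n, and the immersion is given by a
   map R^n -> R^{n+1} whose coordinates are trigonometric polynomials. Let nu be
   the generalized cross product of its partial derivatives. The map is an
   immersion with Gauss map nu / |nu|, and the Gauss map misses x, precisely when
   nu never lies on the closed ray spanned by x; the latter is an open condition.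

   The maps are tubes gamma(s) + d h(t) A(s), d > 0 small, around a closed plane
   curve gamma, where h is an immersion of the torus of one dimension less whose
   Gauss map misses e_0, and A(s) is a loop of frames transverse to gamma'. As
   d -> 0, nu(s, t) becomes orthogonal to gamma'(s) and its coordinates along
   the rows of A(s) become positive multiples of nu_h(t). So X is missed for
   small d as soon as every x in X that is orthogonal to gamma'(s) has positive
   first coordinate and zero other coordinates along A(s). For gamma a circle in
   a generic plane, the points of X are orthogonal to gamma' one at a time, each
   at two opposite parameters, so the frame only has to be prescribed at
   finitely many parameters; this uses that X contains no antipodal pair. The
   base of the induction is the figure eight, whose tangent avoids a direction. *)
Require Import Defs.
From mathcomp Require Import all_boot all_order all_algebra.
From mathcomp Require Import all_classical all_reals all_analysis.
From mathcomp Require Import perm ring lra.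

Set Implicit Arguments.
Unset Strict Implicit.
Unset Printing Implicit Defensive.

Import Order.TTheory GRing.Theory Num.Theory.
Import numFieldNormedType.Exports.

Local Open Scope classical_set_scope.
Local Open Scope ring_scope.

(** * Trigonometric polynomials *)

Section TrigPolynomials.
Context {R : realType}.

(* A syntax for trigonometric polynomials: derivatives stay inside the syntax,
   so smoothness and (2 pi Z)^n-periodicity are automatic. *)
Inductive texp (n : nat) : Type :=
  | TConst of R
  | TCos of 'I_n
  | TSin of 'I_n
  | TAdd of texp n & texp n
  | TMul of texp n & texp n.

Fixpoint teval n (e : texp n) (x : 'rV[R]_n) : R :=
  match e with
  | TConst r => r
  | TCos i => cos (x 0 i)
  | TSin i => sin (x 0 i)
  | TAdd a b => teval a x + teval b x
  | TMul a b => teval a x * teval b x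
  end.

Fixpoint tderiv n (i : 'I_n) (e : texp n) : texp n :=
  match e with
  | TConst r => TConst n 0
  | TCos j => TMul (TConst n (- (i == j)%:R)) (TSin j)
  | TSin j => TMul (TConst n (i == j)%:R) (TCos j)
  | TAdd a b => TAdd (tderiv i a) (tderiv i b)
  | TMul a b => TAdd (TMul (tderiv i a) b) (TMul a (tderiv i b))
  end.

Definition tsum n m (F : 'I_m -> texp n) := \big[@TAdd n/TConst n 0]_(j < m) F j.

Lemma teval_sum n m (F : 'I_m -> texp n) x :
  teval (tsum F) x = \sum_j teval (F j) x.
Proof. exact: (big_morph (fun e => teval e x)). Qed.

Lemma tderiv_sum n m i (F : 'I_m -> texp n) x :
  teval (tderiv i (tsum F)) x = \sum_j teval (tderiv i (F j)) x.
Proof. exact: (big_morph (fun e => teval (tderiv i e) x)). Qed.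

Lemma is_diff_coord n (i : 'I_n) (x : 'rV[R]_n) :
  is_diff x (fun y : 'rV[R]_n => y 0 i : R) (fun v : 'rV[R]_n => v 0 i).
Proof.
have @f : {linear 'rV[R]_n -> R}.
  by exists (fun N : 'rV[R]_n => N 0 i); do 2![eexists]; do ?[constructor];
     rewrite ?mxE// => ? *; rewrite ?mxE//; move=> ?; rewrite !mxE.
apply: DiffDef; first exact: differentiable_coord.
by rewrite -[X in 'd X x]/(f : _ -> _) diff_lin //; exact: coord_continuous.
Qed.

Lemma is_diff_comp_derive n (g : R -> R) (g' : R) (i : 'I_n) (x : 'rV[R]_n) :
  is_derive (x 0 i) 1 g g' ->
  is_diff x (fun y : 'rV[R]_n => g (y 0 i)) (fun v : 'rV[R]_n => v 0 i * g').
Proof.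
move=> hg; have dg : differentiable g (x 0 i) by exact/derivable1_diffP.
have hd : is_diff (x 0 i) g ( *%R^~ g').
  apply: DiffDef => //; rewrite diff1E //.
  by apply/funext => h; rewrite derive1E derive_val.
exact: (is_diff_eq (is_diff_comp (is_diff_coord i x) hd)).
Qed.

Lemma is_diff_teval n (e : texp n) (x : 'rV[R]_n) :
  is_diff x (teval e) (fun v => \sum_i v 0 i * teval (tderiv i e) x).
Proof.
elim: e => [r|j|j|a IHa b IHb|a IHa b IHb] /=.
- apply: (is_diff_eq (is_diff_cst r x)); apply/funext => v.
  by rewrite big1 // => i _; rewrite mulr0.
- apply: (is_diff_eq (is_diff_comp_derive (is_derive_cos (x 0 j)))).
  apply/funext => v; rewrite (bigD1 j) //= eqxx mulN1r big1 ?addr0 // => i /negPf->.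
  by rewrite oppr0 mul0r mulr0.
- apply: (is_diff_eq (is_diff_comp_derive (is_derive_sin (x 0 j)))).
  apply/funext => v; rewrite (bigD1 j) //= eqxx mul1r big1 ?addr0 // => i /negPf->.
  by rewrite mul0r mulr0.
- apply: (is_diff_eq (is_diffD IHa IHb)); apply/funext => v.
  by rewrite -[LHS]/(_ + _) -big_split; apply: eq_bigr => i _; rewrite mulrDr.
- apply: (is_diff_eq (is_diffM IHa IHb)); apply/funext => v.
  rewrite -[LHS]/(_ *: _ + _ *: _) /GRing.scale /= !mulr_sumr -big_split.
  by apply: eq_bigr => i _ /=; ring.
Qed.

Definition tvec n p (e : 'I_p -> texp n) (x : 'rV[R]_n) : 'rV[R]_p :=
  \row_j teval (e j) x.

Definition tjac n p (e : 'I_p -> texp n) (x : 'rV[R]_n) : 'M[R]_(n, p) :=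
  \matrix_(i, j) teval (tderiv i (e j)) x.

Lemma is_diff_tvec n p (e : 'I_p -> texp n) (x : 'rV[R]_n) :
  is_diff x (tvec e) (mulmx^~ (tjac e x)).
Proof.
have -> : tvec e = \sum_(j < p) (fun z => teval (e j) z *: (delta_mx 0 j : 'rV[R]_p)).
  apply/funext => z; rewrite fct_sumE [LHS]row_sum_delta.
  by apply: eq_bigr => j _; rewrite mxE.
have -> : mulmx^~ (tjac e x) = \sum_(j < p) (fun v : 'rV[R]_n =>
    (\sum_i v 0 i * teval (tderiv i (e j)) x) *: (delta_mx 0 j : 'rV[R]_p)).
  apply/funext => v; rewrite fct_sumE [LHS]row_sum_delta.
  by apply: eq_bigr => j _; rewrite !mxE; under eq_bigr do rewrite !mxE.
elim/big_ind2 : _ => [|f df g dg hf hg|j _]; first exact: is_diff_cst.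
  exact: is_diffD.
have hd := is_diff_teval (e j) x.
apply: DiffDef; first by apply: differentiableZl; exact: ex_diff.
by rewrite diffZl; [rewrite diff_val | exact: ex_diff].
Qed.

Lemma continuous_teval n (e : texp n) : continuous (teval e).
Proof.
by move=> x; apply: differentiable_continuous; have := is_diff_teval e x; case.
Qed.

Lemma differentiable_tvec n p (e : 'I_p -> texp n) x : differentiable (tvec e) x.
Proof. by have := is_diff_tvec e x; case. Qed.

Lemma continuous_tvec n p (e : 'I_p -> texp n) : continuous (tvec e).
Proof. by move=> x; apply: differentiable_continuous; exact: differentiable_tvec. Qed.

Lemma diff_tvec n p (e : 'I_p -> texp n) x v : 'd (tvec e) x v = v *m tjac e x.
Proof. by have hd := is_diff_tvec e x; rewrite diff_val. Qed.

Lemma jacobian_tvec n p (e : 'I_p -> texp n) x : 'J (tvec e) x = tjac e x.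
Proof.
by apply/row_matrixP => i; rewrite !rowE mul_rV_lin1 diff_tvec.
Qed.

(** Only the germ at [x] enters a first-order expansion, so that of [g] is also one of [f]. This
    serves changes of charts, which are translations only locally. *)
Lemma near_eq_diff (n p : nat) (f g : 'rV[R]_n -> 'rV[R]_p) x :
  differentiable g x -> (\near x, f x = g x) ->
  differentiable f x /\ 'd f x = 'd g x :> (_ -> _).
Proof.
move=> dg fg.
have fxgx : f x = g x := nbhs_singleton fg.
have dd : f \o shift x = cst (f x) + ('d g x : _ -> _) +o_ 0 id.
  apply/eqaddoP => _/posnumP[eps].
  have /eqaddoP/(_ _ (gt0 eps)) := diff_locally dg.
  have fg0 : \forall h \near (0 : 'rV[R]_n), f (h + x) = g (h + x).
    by have := fg; rewrite (near_shift 0) subr0.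
  apply: filterS2 fg0 => h hh.
  by rewrite !fctE /= hh fxgx; exact.
have cdg : continuous ('d g x : _ -> _) by exact: diff_continuous.
have e := diff_unique cdg dd.
split; last exact: e.
by apply/diff_locallyP; rewrite e; split; [exact: cdg | exact: dd].
Qed.

Definition tderiv_along n (v : 'rV[R]_n) (e : texp n) : texp n :=
  tsum (fun i => TMul (TConst n (v 0 i)) (tderiv i e)).

Lemma diff_tvec_along n p (e : 'I_p -> texp n) x v :
  'd (tvec e) x v = tvec (tderiv_along v \o e) x.
Proof.
rewrite diff_tvec; apply/rowP => j; rewrite !mxE /= teval_sum.
by apply: eq_bigr => i _; rewrite mxE.
Qed.

(** Maps that are locally trigonometric polynomials are stable under taking directional derivatives,
    by [tderiv_along], so the induction on the order stays among them. *)
Lemma smooth_on_near_tvec n p (U : set 'rV[R]_n) (f : 'rV[R]_n -> 'rV[R]_p) :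
  (forall x, U x -> exists e, \near x, f x = tvec e x) -> smooth_on U f.
Proof.
move=> + k; elim: k U f => [|k IHk] U f hf /=.
  apply: continuous_in_subspaceT => x /set_mem /hf[e he].
  rewrite /continuous_at (nbhs_singleton he).
  have hc := @continuous_tvec _ _ e x; apply: cvg_trans hc.
  apply: (@near_eq_cvg _ _ (nbhs x)).
  by near=> y; apply/esym; near: y; exact: he.
split=> [x /hf[e he]|v].
  exact: (near_eq_diff (differentiable_tvec e x) he).1.
apply: IHk => x /hf[e he]; exists (tderiv_along v \o e).
(* The equality near [x] also holds near every [y] close to [x], so the differentials agree on a
   neighbourhood of [x]. *)
have := near_join he; apply: filterS => y hy; rewrite -diff_tvec_along.
exact: (congr1 (@^~ v) (near_eq_diff (differentiable_tvec e y) hy).2).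
Unshelve. all: end_near. Qed.

End TrigPolynomials.

(** * The torus *)

Section Torus.
Context {R : realType} {n : nat}.
Local Open Scope quotient_scope.
Implicit Types x y z a b : 'rV[R]_n.

(** This is congruence modulo [2 pi] in each coordinate. Written with cosines and sines it is
    boolean, and trigonometric polynomials visibly respect it. *)
Definition tequiv x y : bool :=
  [forall i, (cos (x 0 i) == cos (y 0 i)) && (sin (x 0 i) == sin (y 0 i))].

Lemma tequivP x y : reflect
  (forall i, cos (x 0 i) = cos (y 0 i) /\ sin (x 0 i) = sin (y 0 i)) (tequiv x y).
Proof.
apply: (iffP forallP) => h i; first by have /andP[/eqP ? /eqP ?] := h i.
by have [-> ->] := h i; rewrite !eqxx.
Qed.

Lemma tequiv_refl : reflexive tequiv.
Proof. by move=> x; apply/tequivP. Qed.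

Lemma tequiv_sym : symmetric tequiv.
Proof. by move=> x y; apply/tequivP/tequivP => h i; have [-> ->] := h i. Qed.

Lemma tequiv_trans : transitive tequiv.
Proof.
move=> y x z /tequivP xy /tequivP yz; apply/tequivP => i.
by have [-> ->] := xy i.
Qed.

Canonical tequiv_equiv_rel := EquivRel tequiv tequiv_refl tequiv_sym tequiv_trans.

Definition torus : topologicalType := quotient_topology {eq_quot tequiv_equiv_rel}.

Definition tpi x : torus := \pi_(quotient_topology {eq_quot tequiv_equiv_rel}) x.
Definition trepr (p : torus) : 'rV[R]_n := repr p.

Lemma treprK p : tpi (trepr p) = p.
Proof. exact: reprK. Qed.

Lemma tpiP x y : reflect (tpi x = tpi y) (tequiv x y).
Proof. by apply: (iffP idP) => [h|/eqquotP//]; apply/eqquotP. Qed.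

Lemma trepr_tpi x : tequiv (trepr (tpi x)) x.
Proof. by apply/tpiP; rewrite treprK. Qed.

Lemma teval_tequiv (e : texp n) x y : tequiv x y -> teval e x = teval e y.
Proof.
move=> /tequivP h; elim: e => //= [i|i|a -> b ->|a -> b ->] //; by have [] := h i.
Qed.

Lemma tvec_tequiv p (e : 'I_p -> texp n) x y : tequiv x y -> tvec e x = tvec e y.
Proof. by move=> h; apply/rowP => j; rewrite !mxE (teval_tequiv _ h). Qed.

Lemma tjac_tequiv p (e : 'I_p -> texp n) x y : tequiv x y -> tjac e x = tjac e y.
Proof. by move=> h; apply/matrixP => i j; rewrite !mxE (teval_tequiv _ h). Qed.

Lemma tequivDr x y z : tequiv x y -> tequiv (x + z) (y + z).
Proof.
move=> /tequivP h; apply/tequivP => i; have [hc hs] := h i.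
by rewrite !mxE !cosD !sinD hc hs.
Qed.

Lemma tequiv_sub0 x y : tequiv x y -> tequiv (y - x) 0.
Proof. by move=> h; rewrite -(subrr x); apply: tequivDr; rewrite tequiv_sym. Qed.

Lemma cos_eq1_small (d : R) : cos d = 1 -> `|d| < 2 -> d = 0.
Proof.
move=> cd ld; apply/eqP; rewrite -normr_eq0; apply/eqP/cos_inj.
- by rewrite in_itv /= normr_ge0 (le_trans (ltW ld)) // pi_ge2.
- by rewrite in_itv /= lexx pi_ge0.
by rewrite cos0 -cd; case: (ger0P d); rewrite ?cosN.
Qed.

(** Points of a sup-norm ball of radius 1 differ by less than [2 <= pi] in each coordinate, and in
    that range the cosine is 1 only at 0. Hence [tpi] is injective on such balls, which become the
    charts. *)
Lemma tequiv_ball a x y : ball a 1 x -> ball a 1 y -> tequiv x y -> x = y.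
Proof.
move=> ax ay /tequivP h; apply/rowP => i; have [hc hs] := h i.
apply/subr0_eq/cos_eq1_small.
  by rewrite cosB hc hs -!expr2 cos2Dsin2.
have := ax.2 0 i; have := ay.2 0 i; rewrite /ball /= => h1 h2.
have -> : x 0 i - y 0 i = (a 0 i - y 0 i) - (a 0 i - x 0 i) by ring.
by apply: le_lt_trans (ler_normB _ _) _; lra.
Qed.

Lemma tpi_continuous : continuous tpi.
Proof. exact: pi_continuous. Qed.

(** The saturation of [U] is the union of its translates by periods. *)
Lemma tpi_open (U : set 'rV[R]_n) : open U -> open (tpi @` U).
Proof.
move=> oU; rewrite /open /= /quotient_open.
have -> : \pi_(quotient_topology {eq_quot tequiv_equiv_rel}) @^-1` (tpi @` U) =
    \bigcup_(d in [set d | tequiv d 0]) ((fun x => x + d) @^-1` U).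
  rewrite eqEsubset; split => x /=.
    move=> [u Uu /tpiP ux]; exists (u - x) => /=; last by rewrite addrC subrK.
    by apply: tequiv_sub0; rewrite tequiv_sym.
  move=> [d /= d0 Ud]; exists (x + d) => //; apply/tpiP.
  by have := tequivDr x d0; rewrite add0r addrC.
apply: bigcup_open => d _; apply: open_comp => // x _.
by apply: continuousD; [exact: cvg_id | exact: cst_continuous].
Qed.

Lemma torus_continuous (Z : topologicalType) (f : torus -> Z) :
  continuous (f \o tpi) -> continuous f.
Proof. by move=> h; apply/quotient_continuous. Qed.

Lemma continuous_teval_torus (e : texp n) : continuous (teval e \o trepr).
Proof.
apply: torus_continuous; rewrite (_ : _ \o _ = teval e); first exact: continuous_teval.
by apply/funext => x /=; apply: teval_tequiv; exact: trepr_tpi.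
Qed.

(** Trigonometric polynomials descend to continuous real functions on the torus, and the cosines and
    sines of the coordinates separate its points. *)
Lemma torus_hausdorff : hausdorff_space torus.
Proof.
move=> p q pq.
have teval_eq (e : texp n) : teval e (trepr p) = teval e (trepr q).
  apply: (@Rhausdorff R) => A B pA qB.
  have [r [Ar Br]] := pq _ _ (continuous_teval_torus pA) (continuous_teval_torus qB).
  by exists (teval e (trepr r)).
rewrite -(treprK p) -(treprK q); apply/tpiP/tequivP => i.
by split; [exact: (teval_eq (TCos i)) | exact: (teval_eq (TSin i))].
Qed.

(** The base consists of the images of balls with rational centres and radii [1/(k+1)]. *)
Lemma torus_second_countable : @second_countable torus.
Proof.
exists (range (fun qk : 'rV[rat]_n * nat =>
    tpi @` ball (map_mx ratr qk.1 : 'rV[R]_n) (qk.2.+1%:R^-1 : R))).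
  exact: card_le_trans (card_image_le _ _) (countableP _).
split=> [_ [[q k] _ <-]|p A].
  by apply: tpi_open; apply: ball_open.
rewrite -(treprK p); set x := trepr p => /tpi_continuous /nbhs_ballP[e /= e0 xA].
have e2 : 0 < e / 2 by rewrite divr_gt0.
(* With radius below [e / 2], a ball that contains [x] lies in the ball of radius [e] around [x]. *)
have [k _ /(_ _ (leqnn k))/= ke] := near_infty_natSinv_lt (PosNum e2).
set d : R := k.+1%:R^-1 in ke; have d0 : 0 < d by rewrite invr_gt0 ltr0n.
have /choice[q hq] : forall i, exists q : rat, `|ratr q - x 0 i| < d.
  move=> i; have /rat_in_itvoo[q] : x 0 i - d < x 0 i + d by lra.
  by rewrite in_itv /= => hq; exists q; rewrite ltr_distl.
have qx y : ball (map_mx ratr (\row_i q i) : 'rV[R]_n) d y <->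
    (0 < d /\ forall i, `|ratr (q i) - y 0 i| < d).
  split=> [[_ h]|[_ h]]; split=> // i; first by have := h 0 i; rewrite !mxE.
  by move=> j; rewrite ord1 !mxE; exact: h.
exists (tpi @` ball (map_mx ratr (\row_i q i) : 'rV[R]_n) d).
  split; first by exists (\row_i q i, k).
  by exists x => //; apply/qx.
move=> _ [y /qx[_ hy] <-]; apply: xA; split=> // i j; rewrite ord1.
rewrite /ball /=; apply: le_lt_trans (ler_distD (ratr (q j)) _ _) _.
by have := hq j; have := hy j; rewrite distrC; lra.
Qed.

Lemma cosD2piz (t : R) (z : int) : cos (t + pi *+ 2 *~ z) = cos t.
Proof.
case: z => k; first exact: (periodicn (@cosD2pi R)).
by rewrite NegzE mulrNz -pmulrn -(periodicn (@cosD2pi R) k.+1) subrK.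
Qed.

Lemma sinD2piz (t : R) (z : int) : sin (t + pi *+ 2 *~ z) = sin t.
Proof.
case: z => k; first exact: (periodicn (@sinD2pi R)).
by rewrite NegzE mulrNz -pmulrn -(periodicn (@sinD2pi R) k.+1) subrK.
Qed.

Definition tcube : set 'rV[R]_n := [set x | forall i, `[0, pi *+ 2]%classic (x 0 i)].

Lemma tcube_compact : compact tcube.
Proof.
apply: (@rV_compact R n (fun=> `[0, pi *+ 2]%classic)) => i.
exact: segment_compact.
Qed.

Lemma tequiv_tcube x : exists2 y, tcube y & tequiv x y.
Proof.
pose T : R := pi *+ 2; have T0 : 0 < T by rewrite /T pmulrn_lgt0 // pi_gt0.
exists (\row_i (x 0 i + T *~ (- Num.floor (x 0 i / T)))).
  move=> i /=; rewrite in_itv /= mxE mulrNz -mulrzr.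
  have /andP[h1 h2] := floor_itv (x 0 i / T).
  move: h1 h2; rewrite ler_pdivlMr // ltr_pdivrMr // intrD mulrDl mul1r.
  by rewrite -/T [_%:~R * T]mulrC => h1 h2; lra.
by apply/tequivP => i; rewrite mxE /T cosD2piz sinD2piz.
Qed.

Lemma torus_compact : compact [set: torus].
Proof.
have -> : [set: torus] = tpi @` tcube.
  rewrite eqEsubset; split => // p _.
  have [y cy py] := tequiv_tcube (trepr p).
  by exists y => //; rewrite -(treprK p); apply/tpiP; rewrite tequiv_sym.
apply: continuous_compact tcube_compact.
exact/continuous_subspaceT/tpi_continuous.
Qed.

End Torus.
Arguments torus : clear implicits.

(** * Generalized cross product *)

Section CrossProduct.
Context {R : realType}.

Lemma dotvE m (u v : 'rV[R]_m) : dotv u v = (u *m v^T) 0 0.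
Proof. by rewrite mxE; apply: eq_bigr => i _; rewrite mxE. Qed.

Lemma dotvC m (u v : 'rV[R]_m) : dotv u v = dotv v u.
Proof. by apply: eq_bigr => i _; rewrite mulrC. Qed.

Lemma dotvZl m (a : R) (u v : 'rV[R]_m) : dotv (a *: u) v = a * dotv u v.
Proof. by rewrite !dotvE -scalemxAl mxE. Qed.

Lemma dotvDl m (u w v : 'rV[R]_m) : dotv (u + w) v = dotv u v + dotv w v.
Proof. by rewrite !dotvE mulmxDl mxE. Qed.

Lemma dotv0l m (v : 'rV[R]_m) : dotv 0 v = 0.
Proof. by rewrite dotvE mul0mx mxE. Qed.

Lemma dotv_mulmx m p (u : 'rV[R]_p) (v : 'rV[R]_m) (A : 'M[R]_(m, p)) :
  dotv u (v *m A) = dotv (u *m A^T) v.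
Proof. by rewrite !dotvE trmx_mul mulmxA. Qed.

Lemma dotv_delta m (u : 'rV[R]_m) j : dotv u (delta_mx 0 j) = u 0 j.
Proof.
rewrite /dotv (bigD1 j) //= !mxE !eqxx mulr1 big1 ?addr0 // => i /negPf ij.
by rewrite mxE ij andbF mulr0.
Qed.

Lemma dotv_inj m (u v : 'rV[R]_m) : (forall w, dotv u w = dotv v w) -> u = v.
Proof. by move=> h; apply/rowP => j; rewrite -!dotv_delta. Qed.

Lemma dotv_ge0 m (u : 'rV[R]_m) : 0 <= dotv u u.
Proof. by apply: sumr_ge0 => i _; rewrite -expr2 sqr_ge0. Qed.

Lemma dotv_eq0 m (u : 'rV[R]_m) : (dotv u u == 0) = (u == 0).
Proof.
apply/eqP/eqP => [|->]; last exact: dotv0l.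
have h j : true -> 0 <= u 0 j * u 0 j by rewrite -expr2 sqr_ge0.
move=> /(psumr_eq0P h) u0; apply/rowP => i; rewrite mxE; apply/eqP.
by rewrite -sqrf_eq0 expr2 u0.
Qed.

Lemma dotv_gt0 m (u : 'rV[R]_m) : (0 < dotv u u) = (u != 0).
Proof. by rewrite lt_def dotv_ge0 andbT dotv_eq0. Qed.

(** The zero row is a placeholder: cofactors along the top row do not see it, so they are the signed
    maximal minors of [J]. *)
Definition nu n (J : 'M[R]_(n, n.+1)) : 'rV[R]_n.+1 :=
  \row_j cofactor (col_mx (0 : 'rV_n.+1) J : 'M[R]_n.+1) 0 j.

Lemma row'_col_mx n (w : 'rV[R]_n.+1) (J : 'M[R]_(n, n.+1)) :
  row' 0 (col_mx w J : 'M[R]_n.+1) = J.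
Proof.
apply/matrixP => i k; rewrite mxE.
have -> : lift 0 i = rshift 1 i :> 'I_(1 + n) by exact: val_inj.
exact: (@col_mxEd R 1 n n.+1 w J i k).
Qed.

Lemma cofactor_col_mx n (w : 'rV[R]_n.+1) (J : 'M[R]_(n, n.+1)) j :
  cofactor (col_mx w J : 'M[R]_n.+1) 0 j = (-1) ^+ j * \det (col' j J).
Proof.
rewrite /cofactor add0n; congr (_ * \det _).
by rewrite -[J in RHS](row'_col_mx w); apply/matrixP => i k; rewrite !mxE.
Qed.

Lemma nuE n (J : 'M[R]_(n, n.+1)) j : nu J 0 j = (-1) ^+ j * \det (col' j J).
Proof. by rewrite mxE cofactor_col_mx. Qed.

(** Laplace expansion along the top row. So [nu J] represents the linear form [w |-> det (w; J)],
    with the sign that [is_gauss_map] asks for. *)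
Lemma dotv_nu n (J : 'M[R]_(n, n.+1)) (w : 'rV[R]_n.+1) :
  dotv (nu J) w = \det (col_mx w J : 'M[R]_n.+1).
Proof.
rewrite (expand_det_row _ 0); apply: eq_bigr => j _.
rewrite nuE cofactor_col_mx mulrC; congr (_ * _).
have -> : (0 : 'I_(1 + n)) = lshift n 0 by exact: val_inj.
exact: esym (@col_mxEu R 1 n n.+1 w J 0 j).
Qed.

Lemma dotv_nu_mul n (J : 'M[R]_(n, n.+1)) (v : 'rV[R]_n) : dotv (nu J) (v *m J) = 0.
Proof.
rewrite dotv_nu; apply/eqP/det0P; exists (row_mx (1 : 'rV_1) (- v) : 'rV_n.+1).
  apply/eqP => h; have := congr1 (fun A : 'rV[R]_(1 + n) => lsubmx A 0 0) h.
  by rewrite /= row_mxKl !mxE => /eqP; rewrite oner_eq0.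
by rewrite (mul_row_col 1) mul1mx mulNmx subrr.
Qed.

(** If a nonzero [v] kills [J], then [(0, v)] kills [(w; J)] for every [w]; all these determinants
    vanish and [nu J = 0]. This is how nonvanishing of [nu] yields an immersion. *)
Lemma nu_mul_inj n (J : 'M[R]_(n, n.+1)) (v : 'rV[R]_n) :
  nu J != 0 -> v *m J = 0 -> v = 0.
Proof.
move=> + vJ; apply: contraNeq => v0; apply/eqP/dotv_inj => w.
rewrite dotv0l dotv_nu; apply/eqP/det0P; exists (row_mx (0 : 'rV_1) v : 'rV_n.+1).
  apply: contra v0 => /eqP h; apply/eqP.
  have := congr1 (fun A : 'rV[R]_(1 + n) => rsubmx A) h; rewrite /= row_mxKr => ->.
  by apply/matrixP => i j; rewrite !mxE.
apply: etrans (@mul_row_col R 1 1 n n.+1 0 v w J) _; by rewrite mul0mx vJ addr0.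
Qed.

(* u is not in R_+ x (see off_rayP), in a form that is visibly open in u. *)
Definition off_ray m (x u : 'rV[R]_m) : Prop :=
  dotv u x < 0 \/ exists i j, u 0 i * x 0 j != u 0 j * x 0 i.

(** If all 2x2 minors of [u] and [x] vanish then [u] is a multiple of [x], and the scalar product
    gives the sign of the factor. Since [l = 0] is included, [off_ray] also says that [u] is
    nonzero. *)
Lemma off_rayP m (x u : 'rV[R]_m) : x != 0 ->
  off_ray x u <-> (forall l, 0 <= l -> u != l *: x).
Proof.
move=> x0; split=> [+ l l0|h].
  case=> [|[i [j]]]; last by apply: contraNneq => ->; rewrite !mxE; apply/eqP; ring.
  by apply: contraTneq => ->; rewrite dotvZl -leNgt mulr_ge0 // dotv_ge0.
apply: contrapT => /not_orP[/negP ux /forallNP minors]; rewrite -leNgt in ux.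
have {}minors i j : u 0 i * x 0 j = u 0 j * x 0 i.
  by have /forallNP/(_ j)/negP := minors i; rewrite negbK => /eqP.
have [j xj0] : exists j, x 0 j != 0.
  apply: contrapT => /forallNP xz; case/eqP: x0; apply/rowP => j.
  by rewrite mxE; apply/eqP; have /negP := xz j; rewrite negbK.
have ue : u = (u 0 j / x 0 j) *: x.
  by apply/rowP => i; rewrite !mxE mulrAC -minors mulfK.
have l0 : 0 <= u 0 j / x 0 j by move: ux; rewrite {1}ue dotvZl pmulr_lge0 // dotv_gt0.
by have := h _ l0; rewrite -ue eqxx.
Qed.

Lemma off_ray_scale m (x u : 'rV[R]_m) a : 0 < a -> off_ray x u -> off_ray x (a *: u).
Proof.
move=> a0 [ux|[i [j ij]]]; first by left; rewrite dotvZl pmulr_rlt0.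
by right; exists i, j; rewrite !mxE -!mulrA (inj_eq (mulfI (lt0r_neq0 a0))).
Qed.

(** * Continuity of determinants and cross products *)

Lemma continuous_bigsum (T : topologicalType) (I : Type) (r : seq I) (P : pred I)
    (F : I -> T -> R) :
  (forall i, continuous (F i)) -> continuous (fun t => \sum_(i <- r | P i) F i t).
Proof.
move=> hF; elim: r => [|i r IH].
  rewrite (_ : (fun _ => _) = cst 0); first exact: cst_continuous.
  by apply/funext => t; rewrite big_nil.
under eq_fun do rewrite big_cons.
by case: (P i) => // t; apply: continuousD; [exact: hF | exact: IH].
Qed.

Lemma continuous_bigprod (T : topologicalType) (I : Type) (r : seq I) (P : pred I)
    (F : I -> T -> R) :
  (forall i, continuous (F i)) -> continuous (fun t => \prod_(i <- r | P i) F i t).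
Proof.
move=> hF; elim: r => [|i r IH].
  rewrite (_ : (fun _ => _) = cst 1); first exact: cst_continuous.
  by apply/funext => t; rewrite big_nil.
under eq_fun do rewrite big_cons.
by case: (P i) => // t; apply: continuousM; [exact: hF | exact: IH].
Qed.

Lemma continuous_det (T : topologicalType) m (A : T -> 'M[R]_m) :
  (forall i j, continuous (fun t => A t i j)) -> continuous (fun t => \det (A t)).
Proof.
move=> hA.
apply: (@continuous_bigsum T _ _ _ (fun (s : {perm 'I_m}) t => (-1) ^+ s * \prod_i A t i (s i))).
move=> s t.
apply: (@continuousM R T (fun=> (-1) ^+ s) (fun t => \prod_i A t i (s i))).
  exact: cst_continuous.
exact: (@continuous_bigprod T _ _ _ (fun i t => A t i (s i))).
Qed.

Lemma continuous_mulmx (T : topologicalType) m n p (A : T -> 'M[R]_(m, n))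
    (B : T -> 'M[R]_(n, p)) :
  (forall i j, continuous (fun t => A t i j)) ->
  (forall i j, continuous (fun t => B t i j)) ->
  forall i j, continuous (fun t => (A t *m B t) i j).
Proof.
move=> cA cB i j; under eq_fun do rewrite mxE.
apply: (@continuous_bigsum T _ _ _ (fun k t => A t i k * B t k j)) => k t.
by apply: continuousM; [exact: cA | exact: cB].
Qed.

Lemma continuous_nu (T : topologicalType) n (J : T -> 'M[R]_(n, n.+1)) :
  (forall i j, continuous (fun t => J t i j)) ->
  forall j, continuous (fun t => nu (J t) 0 j).
Proof.
move=> hJ j; under eq_fun do rewrite nuE.
move=> t.
apply: (@continuousM R T (fun=> (-1) ^+ j) (fun t => \det (col' j (J t)))).
  exact: cst_continuous.
by apply: continuous_det => i k; under eq_fun do rewrite mxE; exact: hJ.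
Qed.

Lemma continuous_rowP (T : topologicalType) m (f : T -> 'rV[R]_m) :
  (forall j, continuous (fun t => f t 0 j)) -> continuous f.
Proof.
move=> hf t A /nbhs_ballP[e /= e0 eA].
have : \forall t' \near t, forall j, `|f t 0 j - f t' 0 j| < e.
  apply: filter_forall => j.
  by have /cvgrPdist_lt/(_ e e0) := hf j t.
apply: filterS => t' ht'; apply: eA; split=> // i j; rewrite ord1; exact: ht'.
Qed.

End CrossProduct.

(** * Charts of the torus and maps defined on it *)

Section TorusManifold.
Context {R : realType} {n : nat}.
Implicit Types a b x y : 'rV[R]_n.

Definition tdom a : set (torus R n) := tpi @` ball a 1.

Definition tlift a (p : torus R n) : 'rV[R]_n :=
  xget a [set x | ball a 1 x /\ tpi x = p].

Lemma tlift_tpi a x : ball a 1 x -> tlift a (tpi x) = x.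
Proof.
move=> ax; apply: xget_unique => // y [ay /tpiP yx].
exact: (tequiv_ball ay ax yx).
Qed.

Lemma tliftK a p : tdom a p -> tpi (tlift a p) = p.
Proof. by move=> [x ax <-]; rewrite tlift_tpi. Qed.

Lemma ball_tlift a p : tdom a p -> ball a 1 (tlift a p).
Proof. by move=> [x ax <-]; rewrite tlift_tpi. Qed.

Lemma tdom_open a : open (tdom a).
Proof. by apply: tpi_open; exact: ball_open. Qed.

Lemma tlift_image a : tlift a @` tdom a = ball a 1.
Proof.
rewrite eqEsubset; split => [_ [p ap <-]|x ax]; first exact: ball_tlift.
by exists (tpi x); [exists x | exact: tlift_tpi].
Qed.

Lemma tlift_image_open a : open (tlift a @` tdom a).
Proof. by rewrite tlift_image; exact: ball_open. Qed.

Lemma tlift_continuous a : {within tdom a, continuous (tlift a)}.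
Proof.
rewrite continuous_open_subspace; last exact: tdom_open.
move=> p /set_mem[x ax <-] A; rewrite /continuous_at tlift_tpi // => xA.
have : open_nbhs (tpi x) (tpi @` (interior A `&` ball a 1)).
  split; last first.
    by exists x => //; split => //; exact: nbhs_singleton (nbhs_interior xA).
  by apply: tpi_open; apply: openI; [exact: open_interior | exact: ball_open].
move=> /open_nbhs_nbhs; apply: filterS => _ [y [Ay ay] <-] /=.
by rewrite tlift_tpi //; exact: interior_subset.
Qed.

Lemma tpi_continuous_within a : {within tlift a @` tdom a, continuous (@tpi R n)}.
Proof. exact/continuous_subspaceT/tpi_continuous. Qed.

Definition tchart a : chart R n (torus R n) :=
  Chart (@tdom_open a) (@tlift_image_open a) (@tliftK a) (@tlift_continuous a)
    (@tpi_continuous_within a).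

(** If [y] represents the class of [x] in the ball around [b], then [y - x] is a period, and adding
    it keeps points near [x] inside that ball. *)
Lemma tlift_transition a b x : ball a 1 x -> tdom b (tpi x) ->
  exists d, \near x, (tlift b \o tpi) x = x + d.
Proof.
move=> ax [y yb /tpiP yx]; exists (y - x).
have : \forall x' \near x, ball b 1 (x' + (y - x)).
  have : continuous (fun x' : 'rV[R]_n => x' + (y - x)).
    by move=> z; apply: (@continuousD R _ _ id (cst (y - x)) z); [exact: cvg_id | exact: cst_continuous].
  move=> /(_ x); apply; rewrite [x + _]addrC subrK.
  by apply: open_nbhs_nbhs; split; [exact: ball_open | exact: yb].
apply: filterS => x' hx' /=; rewrite -[RHS](tlift_tpi hx'); congr tlift.
rewrite tequiv_sym in yx; apply/tpiP; have := tequivDr x' (tequiv_sub0 yx).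
by rewrite add0r tequiv_sym [y - x + x']addrC.
Qed.

Lemma near_translation x (f : 'rV[R]_n -> 'rV[R]_n) d :
  (\near x, f x = x + d) -> differentiable f x /\ 'd f x = id :> (_ -> _).
Proof.
move=> fd.
have h : is_diff x (fun y : 'rV[R]_n => y + d) id.
  by apply: (is_diff_eq (is_diffD (is_diff_id x) (is_diff_cst d x))); rewrite addr0.
have dg : differentiable (fun y : 'rV[R]_n => y + d) x by case: h.
have [? ->] := near_eq_diff dg fd.
by split=> //; rewrite diff_val.
Qed.

(** A translation is not a trigonometric polynomial, but its directional derivatives are constants,
    to which [smooth_on_near_tvec] applies. *)
Lemma smooth_on_near_translation (U : set 'rV[R]_n) (f : 'rV[R]_n -> 'rV[R]_n) :
  (forall x, U x -> exists d, \near x, f x = x + d) -> smooth_on U f.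
Proof.
move=> hf [|k] /=.
  apply: continuous_in_subspaceT => x /set_mem /hf[d hd].
  by apply: differentiable_continuous; exact: (near_translation hd).1.
split=> [x /hf[d hd]|v]; first exact: (near_translation hd).1.
apply: smooth_on_near_tvec => x /hf[d hd].
exists (fun j => TConst n (v 0 j)).
have := near_join hd; apply: filterS => y hy.
have -> : 'd f y v = v by exact: (congr1 (@^~ v) (near_translation hy).2).
by apply/rowP => j; rewrite !mxE.
Qed.

Definition tatlas : set (chart R n (torus R n)) := range tchart.

Lemma tatlas_cover (p : torus R n) : exists2 c, tatlas c & cdom c p.
Proof.
exists (tchart (trepr p)); first by exists (trepr p).
by exists (trepr p); [exact: ballxx | exact: treprK].
Qed.

Lemma tatlas_transition c d p : tatlas c -> tatlas d -> (cdom c `&` cdom d) p ->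
  exists v, \forall x \near cmap c p, (cmap d \o cinv c) x = x + v.
Proof.
move=> [a _ <-] [b _ <-] /= [ap bp]; apply: tlift_transition (ball_tlift ap) _.
by rewrite tliftK.
Qed.

Lemma tatlas_smooth c d : tatlas c -> tatlas d ->
  smooth_on (cmap c @` (cdom c `&` cdom d)) (cmap d \o cinv c).
Proof.
move=> cA dA; apply: smooth_on_near_translation => _ [p cdp <-].
exact: tatlas_transition.
Qed.

Lemma tatlas_oriented c d : tatlas c -> tatlas d ->
  forall p, (cdom c `&` cdom d) p -> 0 < \det ('J (cmap d \o cinv c) (cmap c p)).
Proof.
move=> cA dA p cdp; have [v hv] := tatlas_transition cA dA cdp.
have -> : 'J (cmap d \o cinv c) (cmap c p) = 1%:M.
  apply/row_matrixP => i; rewrite !rowE mul_rV_lin1 mulmx1.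
  exact: (congr1 (@^~ _) (near_translation hv).2).
by rewrite det1.
Qed.

Definition torus_manifold : orientedManifold R n :=
  OrientedManifold (@torus_hausdorff R n) (@torus_second_countable R n)
    tatlas_cover tatlas_smooth tatlas_oriented.

End TorusManifold.

Lemma torus_gauss_map (R : realType) (n : nat) (X : set 'rV[R]_n.+1)
    (e : 'I_n.+1 -> texp n) :
  (forall x, X x -> x != 0) -> (forall t, nu (tjac e t) != 0) ->
  (forall t x, X x -> off_ray x (nu (tjac e t))) ->
  exists (N : orientedManifold R n) (F G : N -> 'rV[R]_n.+1),
    [/\ [set: N] !=set0, compact [set: N], immersion F, is_gauss_map F G &
        range G `&` X = set0].
Proof.
move=> X0 nu0 nuX.
pose F (p : torus R n) := tvec e (trepr p).
pose m (t : 'rV[R]_n) := nu (tjac e t).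
pose nm t := Num.sqrt (dotv (m t) (m t)).
pose g t := (nm t)^-1 *: m t.
pose G (p : torus R n) := g (trepr p).
have nm0 t : 0 < nm t by rewrite sqrtr_gt0 dotv_gt0; exact: nu0.
have Fpi : F \o tpi = tvec e.
  by apply/funext => t; apply: tvec_tequiv; exact: trepr_tpi.
have Gpi t : G (tpi t) = g t.
  by rewrite /G /g /nm /m (tjac_tequiv _ (trepr_tpi t)).
have mc j : continuous (fun t => m t 0 j).
  apply: (@continuous_nu R _ n (tjac e)) => i k.
  by under eq_fun do rewrite mxE; exact: continuous_teval.
have gc : continuous g.
  apply: continuous_rowP => j t; under eq_fun do rewrite mxE.
  apply: (@continuousM R _ (fun t => (nm t)^-1) (fun t => m t 0 j)); last exact: mc.
  apply: continuousV; first by rewrite gt_eqF.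
  apply: (@continuous_comp _ _ _ (fun t => dotv (m t) (m t))).
    apply: (@continuous_bigsum R _ _ _ _ (fun i t => m t 0 i * m t 0 i)) => i s.
    by apply: continuousM; exact: mc.
  exact: sqrt_continuous.
exists torus_manifold, F, G; split.
- by exists (tpi 0 : torus_manifold).
- exact: (@torus_compact R n).
(* Every [cinv] is [tpi], so [F] reads as the same map [tvec e] in all charts. *)
- split=> [_ [a _ <-]|_ [a _ <-] p ap] /=; rewrite Fpi.
    by apply: smooth_on_near_tvec => x _; exists e; exact: filterE.
  by move=> u v; rewrite !diff_tvec => /eqP; rewrite -subr_eq0 -mulmxBl => /eqP
    /(nu_mul_inj (nu0 _)) /subr0_eq.
- split.
  + apply: torus_continuous; rewrite (_ : _ \o _ = g); first exact: gc.
    by apply/funext => t; exact: Gpi.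
  + move=> p; rewrite /sphere /= /G /g dotvZl dotvC dotvZl.
    by rewrite -[dotv _ _](sqr_sqrtr (dotv_ge0 _)) -/(nm _) expr2 mulKf ?mulVf ?gt_eqF.
  + move=> _ [a _ <-] p ap v /=; rewrite Fpi diff_tvec.
    rewrite -{1}(tliftK ap) Gpi dotvZl dotv_nu_mul mulr0 //.
  + move=> _ [a _ <-] p ap /=; rewrite Fpi jacobian_tvec -dotv_nu dotvC.
    rewrite -{1}(tliftK ap) Gpi dotvZl mulr_gt0 ?invr_gt0 // dotv_gt0; exact: nu0.
rewrite eqEsubset; split => // x [[p _ <-]].
set t := trepr p => Xg.
(* If the Gauss map took the value [x], then [nu] would be [nm t *: x], on the excluded ray. *)
have /(off_rayP _ (X0 _ Xg))/(_ (nm t) (ltW (nm0 t))) := nuX t _ Xg.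
by rewrite scalerA divff ?gt_eqF // scale1r eqxx.
Qed.

(** * Tubes *)

Section Renaming.
Context {R : realType} {n m : nat} (phi : 'I_n -> 'I_m).
Implicit Types (e : @texp R n) (x : 'rV[R]_m).

Fixpoint tren e : texp m :=
  match e with
  | TConst r => TConst m r
  | TCos i => TCos (phi i)
  | TSin i => TSin (phi i)
  | TAdd a b => TAdd (tren a) (tren b)
  | TMul a b => TMul (tren a) (tren b)
  end.

Lemma teval_ren e x : teval (tren e) x = teval e (\row_i x 0 (phi i)).
Proof. by elim: e => //= [i|i|a -> b ->|a -> b ->] //; rewrite mxE. Qed.

Lemma tderiv_ren e i : injective phi -> tderiv (phi i) (tren e) = tren (tderiv i e).
Proof.
move=> inj_phi.
by elim: e => //= [j|j|a -> b ->|a -> b ->] //; rewrite (inj_eq inj_phi).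
Qed.

Lemma tderiv_ren0 e i x : (forall j, i != phi j) -> teval (tderiv i (tren e)) x = 0.
Proof.
move=> h; elim: e => //= [j|j|a -> b ->|a -> b ->].
- by rewrite (negPf (h j)) oppr0 mul0r.
- by rewrite (negPf (h j)) mul0r.
- by rewrite addr0.
- by rewrite mul0r mulr0 addr0.
Qed.

End Renaming.

(** * Cross products with a distinguished first row *)

Section Step.
Context {R : realType}.

Lemma det_col_mx_swap k (u v : 'rV[R]_k.+2) (K : 'M[R]_(k, k.+2)) :
  \det (col_mx u (col_mx v K) : 'M[R]_k.+2) = - \det (col_mx v (col_mx u K) : 'M[R]_k.+2).
Proof.
have -> : (col_mx v (col_mx u K) : 'M[R]_k.+2) =
    xrow 0 1 (col_mx u (col_mx v K) : 'M[R]_k.+2).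
  have e0 : (0 : 'I_(1 + (1 + k))) = lshift (1 + k) 0 by exact: val_inj.
  have e1 : (1 : 'I_(1 + (1 + k))) = rshift 1 (lshift k 0) by exact: val_inj.
  apply/matrixP => i j; rewrite [RHS]mxE; case: tpermP => [->|->|].
  - rewrite e0 e1 (@col_mxEu R 1 k.+1) (@col_mxEd R 1 k.+1).
    by rewrite (@col_mxEu R 1 k).
  - rewrite e0 e1 (@col_mxEu R 1 k.+1) (@col_mxEd R 1 k.+1).
    by rewrite (@col_mxEu R 1 k).
  move=> i0 i1; case: (@split_ordP 1 k.+1 i) => i' ie.
    by case: i0; rewrite ie ord1; exact: val_inj.
  case: (@split_ordP 1 k i') => i'' ie'.
    by case: i1; rewrite ie ie' ord1; exact: val_inj.
  by rewrite ie ie' !(@col_mxEd R 1 k.+1) !(@col_mxEd R 1 k).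
by rewrite xrowE det_mulmx det_perm odd_tperm /= expr1 mulN1r opprK.
Qed.

(** Exchanging the first row with the test vector [w] only changes a sign, so linearity in that row
    becomes linearity of the scalar product. *)
Lemma nu_col_mx_linear k (a : R) (g b : 'rV[R]_k.+2) (K : 'M[R]_(k, k.+2)) :
  nu (col_mx (a *: g + b) K : 'M[R]_(k.+1, k.+2)) =
  a *: nu (col_mx g K : 'M[R]_(k.+1, k.+2)) + nu (col_mx b K : 'M[R]_(k.+1, k.+2)).
Proof.
have nu_swap (g' w : 'rV[R]_k.+2) : dotv (nu (col_mx g' K : 'M[R]_(k.+1, k.+2))) w =
    - dotv (nu (col_mx w K : 'M[R]_(k.+1, k.+2))) g'.
  by rewrite !dotv_nu det_col_mx_swap.
apply: dotv_inj => w; rewrite nu_swap dotvC dotvDl dotvZl [RHS]dotvDl [in RHS]dotvZl.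
by rewrite (dotvC g) (dotvC b) (nu_swap g) (nu_swap b); ring.
Qed.

Lemma dotv_nu_col_mx_self k (g : 'rV[R]_k.+2) (K : 'M[R]_(k, k.+2)) :
  dotv (nu (col_mx g K : 'M[R]_(k.+1, k.+2))) g = 0.
Proof. by rewrite dotv_nu; have := det_col_mx_swap g g K; lra. Qed.

(** After a row swap, [(g; v A; J A)] factors as [diag (1, (v; J))] times [(g; A)]. So the scalar
    products of the new cross product with the rows of [A] are the coordinates of [nu J] times
    [- det (g; A)]. *)
Lemma dotv_nu_col_mx_mul k (g : 'rV[R]_k.+2) (J : 'M[R]_(k, k.+1))
    (A : 'M[R]_(k.+1, k.+2)) (v : 'rV[R]_k.+1) :
  dotv (nu (col_mx g (J *m A) : 'M[R]_(k.+1, k.+2))) (v *m A) =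
  - \det (col_mx g A : 'M[R]_k.+2) * dotv (nu J) v.
Proof.
rewrite !dotv_nu det_col_mx_swap.
have -> : (col_mx g (col_mx (v *m A) (J *m A)) : 'M[R]_k.+2) =
  (block_mx (1%:M : 'M[R]_1) 0 0 (col_mx v J : 'M[R]_k.+1)) *m (col_mx g A : 'M[R]_k.+2).
  rewrite (@mul_block_col R 1 k.+1 1 k.+1 k.+2) mul1mx !mul0mx addr0 add0r.
  exact: (congr1 (fun B : 'M[R]_(k.+1, k.+2) => col_mx g B)
    (esym (@mul_col_mx R 1 k _ _ v J A))).
by rewrite det_mulmx (@det_ublock R 1 k.+1) det1 mul1r mulNr mulrC.
Qed.

(** Suppose the cross product is [l *: x] with [l >= 0]. Then [nu J] is [l / - d] times [x *m A^T].
    If [l = 0] this is zero; if [l > 0], orthogonality to [g] forces [dotv x g = 0], and [nu J] is a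
    positive multiple of the first basis vector. Both are excluded for [nu J]. *)
Lemma off_ray_nu_col_mx k (g x : 'rV[R]_k.+2) (J : 'M[R]_(k, k.+1))
    (A : 'M[R]_(k.+1, k.+2)) :
  x != 0 -> off_ray (delta_mx 0 0) (nu J) -> \det (col_mx g A : 'M[R]_k.+2) < 0 ->
  (dotv x g = 0 -> exists2 c, 0 < c & x *m A^T = c *: delta_mx 0 0) ->
  off_ray x (nu (col_mx g (J *m A) : 'M[R]_(k.+1, k.+2))).
Proof.
set d := \det _ => x0 Joff d0 hx; apply/off_rayP => // l l0; apply/eqP => ul.
have e0 : (delta_mx 0 0 : 'rV[R]_k.+1) != 0.
  by apply/eqP => /matrixP/(_ 0 0); rewrite !mxE => /eqP; rewrite oner_eq0.
have /(off_rayP _ e0) {}Joff := Joff.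
have nuJ v : dotv (nu J) v = l / - d * dotv (x *m A^T) v.
  have := dotv_nu_col_mx_mul g J A v; rewrite ul dotvZl dotv_mulmx -/d => h.
  apply: (mulfI (_ : - d != 0)); first by rewrite oppr_eq0 lt_eqF.
  by rewrite -h mulrA mulrCA divff ?mulr1 // oppr_eq0 lt_eqF.
move: l0; rewrite le_eqVlt => /orP[/eqP l0|l0].
  have /negP := Joff 0 (lexx _); apply; rewrite scale0r; apply/eqP/dotv_inj => v.
  by rewrite nuJ -l0 !mul0r dotv0l.
have [|c c0 xA] := hx.
  have := dotv_nu_col_mx_self g (J *m A); rewrite ul dotvZl => /eqP.
  by rewrite mulf_eq0 gt_eqF //= => /eqP.
have lc0 : 0 <= l / - d * c by rewrite mulr_ge0 ?divr_ge0 ?oppr_ge0 ?ltW.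
have /negP := Joff _ lc0; apply.
by apply/eqP/dotv_inj => v; rewrite nuJ xA !dotvZl mulrA.
Qed.

(** Both alternatives of [off_ray] are open conditions on functions continuous in [(t', d)], and
    they hold at [(t, 0)]. *)
Lemma near_off_ray (T : topologicalType) m (u0 u1 : T -> 'rV[R]_m) (x : 'rV[R]_m) t :
  (forall j, continuous (fun t => u0 t 0 j)) ->
  (forall j, continuous (fun t => u1 t 0 j)) ->
  off_ray x (u0 t) ->
  \forall t' \near t & d \near (0 : R), off_ray x (u0 t' + d *: u1 t').
Proof.
move=> c0 c1.
have cont (a b : T -> R) : continuous a -> continuous b ->
    continuous (fun p : T * R => a p.1 + p.2 * b p.1).
  move=> ca cb p; apply: (@continuousD R _ _ (fun p : T * R => a p.1)
    (fun p : T * R => p.2 * b p.1)).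
    by apply: continuous_comp; [exact: cvg_fst | exact: ca].
  apply: (@continuousM R _ (fun p : T * R => p.2) (fun p : T * R => b p.1)).
    exact: cvg_snd.
  by apply: continuous_comp; [exact: cvg_fst | exact: cb].
have cdot (u : T -> 'rV[R]_m) : (forall j, continuous (fun t => u t 0 j)) ->
    continuous (fun t => dotv (u t) x).
  move=> cu; apply: (@continuous_bigsum R _ _ _ _ (fun i t => u t 0 i * x 0 i)).
  by move=> i s; apply: continuousM; [exact: cu | exact: cst_continuous].
have cminor (u : T -> 'rV[R]_m) i j : (forall j, continuous (fun t => u t 0 j)) ->
    continuous (fun t => u t 0 i * x 0 j - u t 0 j * x 0 i).
  move=> cu s; apply: (@continuousB R _ _ (fun t => u t 0 i * x 0 j)
    (fun t => u t 0 j * x 0 i)).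
    by apply: continuousM; [exact: cu | exact: cst_continuous].
  by apply: continuousM; [exact: cu | exact: cst_continuous].
case=> [ux|[i [j ij]]].
  have := cont _ _ (cdot _ c0) (cdot _ c1) (t, 0) => /cvgr_lt/(_ 0).
  rewrite /= mul0r addr0 => /(_ ux); apply: filterS => p /= hp.
  by left; rewrite dotvDl dotvZl.
have := cont _ _ (cminor _ i j c0) (cminor _ i j c1) (t, 0) => /cvgr_neq0.
rewrite /= mul0r addr0 subr_eq0 => /(_ ij); apply: filterS => p /= hp.
right; exists i, j; rewrite -subr_eq0; apply: contra hp => /eqP hp; apply/eqP.
by rewrite -hp !mxE; ring.
Qed.

(** Compactness of [C] makes the neighbourhoods of [d = 0] given by [near_off_ray] uniform in [t];
    induction on [X] intersects finitely many of them. *)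
Lemma compact_off_ray (T : topologicalType) (C : set T) m (u0 u1 : T -> 'rV[R]_m)
    (X : seq 'rV[R]_m) :
  compact C ->
  (forall j, continuous (fun t => u0 t 0 j)) ->
  (forall j, continuous (fun t => u1 t 0 j)) ->
  (forall t x, C t -> x \in X -> off_ray x (u0 t)) ->
  exists2 d : R, 0 < d & forall t x, C t -> x \in X -> off_ray x (u0 t + d *: u1 t).
Proof.
move=> /compact_near_coveringP cC c0 c1 hoff.
have : \forall d \near (0 : R), forall x, x \in X ->
    forall t, C t -> off_ray x (u0 t + d *: u1 t).
  elim: X hoff => [_|x X IH hoff]; first by apply: filterE => d x; rewrite in_nil.
  have hx : \forall d \near (0 : R), C `<=` (fun t => off_ray x (u0 t + d *: u1 t)).
    apply: (cC R (nbhs (0 : R)) (fun d t => off_ray x (u0 t + d *: u1 t)) _) => t Ct.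
    exact: near_off_ray c0 c1 (hoff t x Ct (mem_head _ _)).
  have {}IH := IH (fun t y Ct yX => hoff t y Ct (mem_behead (s := x :: X) yX)).
  near=> d => y; rewrite in_cons => /orP[/eqP ->|yX] t Ct.
    by have : C `<=` (fun t => off_ray x (u0 t + d *: u1 t)); [near: d | apply].
  have : forall x, x \in X -> forall t, C t -> off_ray x (u0 t + d *: u1 t).
    by near: d.
  by apply.
move=> /nbhs_ballP[e /= e0 he]; exists (e / 2); first by rewrite divr_gt0.
move=> t x Ct xX; apply: he => //; rewrite /ball /= sub0r normrN gtr0_norm ?divr_gt0 //.
lra.
Unshelve. all: end_near. Qed.

Definition tmat n p q (A : 'I_p -> 'I_q -> @texp R n) (s : 'rV[R]_n) : 'M[R]_(p, q) :=
  \matrix_(i, j) teval (A i j) s.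

(** * The tube and its Jacobian *)

Section Tube.
Variables (k : nat) (h : 'I_k.+1 -> @texp R k).
Variables (gam : 'I_k.+2 -> @texp R 1) (A : 'I_k.+1 -> 'I_k.+2 -> @texp R 1).

(** The tube of radius [1 / L] around [gam], enlarged by the factor [L]. Scaling leaves the Gauss
    map unchanged and makes [nu] affine in [L]. The first variable runs along the curve, the others
    over the domain of [h]. *)
Definition tube (L : R) (j : 'I_k.+2) : @texp R k.+1 :=
  TAdd (TMul (TConst _ L) (tren (@lshift 1 k) (gam j)))
       (tsum (fun l => TMul (tren (@rshift 1 k) (h l)) (tren (@lshift 1 k) (A l j)))).

Let A' (i : 'I_k.+1) (j : 'I_k.+2) := tderiv 0 (A i j).

Lemma tjac_tube L (s : 'rV[R]_1) (t : 'rV[R]_k) :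
  tjac (tube L) (row_mx s t) =
  col_mx (L *: tjac gam s + tvec h t *m tmat A' s) (tjac h t *m tmat A s).
Proof.
have el (e : @texp R 1) : teval (tren (@lshift 1 k) e) (row_mx s t) = teval e s.
  by rewrite teval_ren; congr teval; apply/rowP => i; rewrite mxE (row_mxEl s t).
have er (e : @texp R k) : teval (tren (@rshift 1 k) e) (row_mx s t) = teval e t.
  by rewrite teval_ren; congr teval; apply/rowP => i; rewrite mxE (row_mxEr s t).
apply/matrixP => i j; rewrite mxE /= tderiv_sum.
case: (@split_ordP 1 k i) => {}i ->.
  rewrite (@col_mxEu R 1 k) !mxE ord1 tderiv_ren; last exact: lshift_inj.
  rewrite !el mul0r add0r; congr (_ + _); apply: eq_bigr => l _ /=.
  rewrite !mxE tderiv_ren0 ?mul0r ?add0r ?er ?tderiv_ren ?el //.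
  exact: lshift_inj.
rewrite (@col_mxEd R 1 k) !mxE.
rewrite mul0r add0r [teval (tderiv _ (tren _ (gam j))) _]tderiv_ren0; last first.
  by move=> l'; rewrite -val_eqE /= ord1.
rewrite mulr0 add0r; apply: eq_bigr => l _ /=; rewrite !mxE.
rewrite [teval (tderiv _ (tren _ (A l j))) _]tderiv_ren0; last first.
  by move=> l'; rewrite -val_eqE /= ord1.
by rewrite mulr0 addr0 (tderiv_ren _ _ (@rshift_inj 1 k)) er el.
Qed.

(** By linearity in the first row, [nu] of the tube is [L *: u0 + u1], a positive multiple of
    [u0 + d *: u1] for [L = d^-1]. The limit [u0] is handled by [off_ray_nu_col_mx], and by
    periodicity compactness of [tcube] suffices to find [d]. *)
Lemma tube_off_rays (X : seq 'rV[R]_k.+2) :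
  (forall x, x \in X -> x != 0) ->
  (forall t, off_ray (delta_mx 0 0) (nu (tjac h t))) ->
  (forall s, \det (col_mx (tjac gam s) (tmat A s) : 'M[R]_k.+2) < 0) ->
  (forall s x, x \in X -> dotv x (tjac gam s) = 0 ->
    exists2 c, 0 < c & x *m (tmat A s)^T = c *: delta_mx 0 0) ->
  exists f : 'I_k.+2 -> @texp R k.+1,
    forall t x, x \in X -> off_ray x (nu (tjac f t)).
Proof.
move=> X0 hoff hdet hA.
pose s (t : 'rV[R]_(1 + k)) := lsubmx t; pose r (t : 'rV[R]_(1 + k)) := rsubmx t.
pose K t := tjac h (r t) *m tmat A (s t).
pose u0 (t : 'rV[R]_k.+1) := nu (col_mx (tjac gam (s t)) (K t) : 'M[R]_(k.+1, k.+2)).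
pose u1 (t : 'rV[R]_k.+1) :=
  nu (col_mx (tvec h (r t) *m tmat A' (s t)) (K t) : 'M[R]_(k.+1, k.+2)).
have cs (e : @texp R 1) : continuous (fun t : 'rV[R]_k.+1 => teval e (s t)).
  have -> : (fun t : 'rV[R]_k.+1 => teval e (s t)) = teval (tren (@lshift 1 k) e).
    by apply/funext => t; rewrite teval_ren; congr teval; apply/rowP => i; rewrite !mxE.
  exact: continuous_teval.
have cr (e : @texp R k) : continuous (fun t : 'rV[R]_k.+1 => teval e (r t)).
  have -> : (fun t : 'rV[R]_k.+1 => teval e (r t)) = teval (tren (@rshift 1 k) e).
    by apply/funext => t; rewrite teval_ren; congr teval; apply/rowP => i; rewrite !mxE.
  exact: continuous_teval.
have cA (B : 'I_k.+1 -> 'I_k.+2 -> @texp R 1) i j :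
    continuous (fun t : 'rV[R]_k.+1 => tmat B (s t) i j).
  by under eq_fun do rewrite mxE; exact: cs.
have cK i j : continuous (fun t : 'rV[R]_k.+1 => K t i j).
  apply: continuous_mulmx => [i' l|l j']; last exact: cA.
  by under eq_fun do rewrite mxE; exact: cr.
have ccol (g : 'rV[R]_k.+1 -> 'rV[R]_k.+2) :
    (forall j, continuous (fun t => g t 0 j)) ->
    forall j, continuous (fun t => nu (col_mx (g t) (K t) : 'M[R]_(k.+1, k.+2)) 0 j).
  move=> cg; apply: continuous_nu => i j; case: (@split_ordP 1 k i) => {}i ->.
    by rewrite ord1; under eq_fun do rewrite (@col_mxEu R 1 k); exact: cg.
  by under eq_fun do rewrite (@col_mxEd R 1 k); exact: cK.
have [|||d d0 hd] := @compact_off_ray _ (@tcube R k.+1) _ u0 u1 X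
    (@tcube_compact R k.+1).
- by apply: ccol => j; under eq_fun do rewrite mxE; exact: cs.
- apply: ccol; apply: continuous_mulmx => [i' l|l j']; last exact: cA.
  by under eq_fun do rewrite mxE; exact: cr.
- move=> t x _ xX; apply: off_ray_nu_col_mx; [exact: X0|exact: hoff|exact: hdet|].
  exact: hA.
exists (tube d^-1) => t x xX; have [y cy ty] := tequiv_tcube t.
rewrite (tjac_tequiv _ ty).
have -> : y = row_mx (s y) (r y) by rewrite hsubmxK.
rewrite tjac_tube nu_col_mx_linear -/(u0 y) -/(u1 y).
have -> : d^-1 *: u0 y + u1 y = d^-1 *: (u0 y + d *: u1 y).
  by rewrite scalerDr scalerA mulVf ?scale1r // gt_eqF.
by apply: off_ray_scale; [rewrite invr_gt0 | exact: hd].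
Qed.

End Tube.
End Step.

Lemma det_mx2 (R : realType) (A : 'M[R]_2) : \det A = A 0 0 * A 1 1 - A 0 1 * A 1 0.
Proof.
have e1 : lift (0 : 'I_2) 0 = 1 by exact: val_inj.
have e0 : lift (1 : 'I_2) 0 = 0 by exact: val_inj.
rewrite (expand_det_row A 0) big_ord_recl big_ord1 /cofactor !det_mx11 !mxE e1 e0 /=.
by rewrite addn0 expr0 mul1r addn1 expr1 mulN1r mulrN.
Qed.

(** * Frames along a circle *)

Section Frame.
Context {R : realType} {m : nat}.
Variable X : seq 'rV[R]_m.+3.
Hypothesis X_uniq : uniq X.
Hypothesis X_proj : forall x, x \in X -> x 0 0 != 0.
Hypothesis X_indep : forall x y, x \in X -> y \in X -> x != y ->
  x 0 0 * y 0 1 - x 0 1 * y 0 0 != 0.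

Implicit Types (x y : 'rV[R]_m.+3) (s : 'rV[R]_1).
Let E := @texp R 1.

(* With C = (cos s, sin s), [dot x] and [det2 x] are the scalar product and the
   determinant of C with the first two coordinates of x. Parameters where
   [det2 x] vanishes are the nodes of x, and [wgt x] is positive at the nodes of
   x and vanishes at those of the other points of X. The functions below are
   such that at a node of x, with w = wgt x and a = dot x,
     alpha = w a, beta = 0, kappa = w a^2, shear = w a (x_2, x_3, ...).
   The sums interpolate without division: only ratios matter at a node. *)
Let dot x : E := TAdd (TMul (TConst 1 (x 0 0)) (TCos 0)) (TMul (TConst 1 (x 0 1)) (TSin 0)).
Let det2 x : E :=
  TAdd (TMul (TConst 1 (x 0 0)) (TSin 0)) (TMul (TConst 1 (- x 0 1)) (TCos 0)).
Let wgt x : E :=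
  \big[@TMul R 1/TConst 1 1]_(y <- X | y != x) TMul (det2 y) (det2 y).
Let sumX (F : 'rV[R]_m.+3 -> E) : E := \big[@TAdd R 1/TConst 1 0]_(y <- X) F y.
Let alpha : E := sumX (fun y => TMul (wgt y) (dot y)).
Let beta : E := \big[@TMul R 1/TConst 1 1]_(y <- X) det2 y.
Let kappa : E := TAdd (TMul beta beta) (sumX (fun y => TMul (wgt y) (TMul (dot y) (dot y)))).
Let shear (b : 'I_m.+1) : E :=
  sumX (fun y => TMul (TMul (wgt y) (dot y)) (TConst 1 (y 0 (rshift 2 b)))).

Let teval_sumX F s : teval (sumX F) s = \sum_(y <- X) teval (F y) s.
Proof. exact: (big_morph (fun e : E => teval e s)). Qed.

Let teval_wgt x s : teval (wgt x) s = \prod_(y <- X | y != x) teval (det2 y) s ^+ 2.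
Proof.
by rewrite (big_morph (fun e : E => teval e s) (id1 := 1) (op1 := *%R)).
Qed.

Let teval_beta s : teval beta s = \prod_(y <- X) teval (det2 y) s.
Proof. exact: (big_morph (fun e : E => teval e s)). Qed.

(** * Values at the nodes *)

Section Node.
Variables (x : 'rV[R]_m.+3) (s : 'rV[R]_1).
Hypothesis (xX : x \in X) (x_node : teval (det2 x) s = 0).

(** Rotating back gives [x_0 = cos * dot x + sin * det2 x], and [x_0] is nonzero. *)
Lemma node_dot_neq0 : teval (dot x) s != 0.
Proof.
apply: contra_neq (X_proj xX) => /= ds.
have cs := cos2Dsin2 (s 0 0); move: x_node ds => /= h1 h2.
transitivity (x 0 0 * (cos (s 0 0) ^+ 2 + sin (s 0 0) ^+ 2)); first by rewrite cs mulr1.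
transitivity (cos (s 0 0) * (x 0 0 * cos (s 0 0) + x 0 1 * sin (s 0 0)) +
  sin (s 0 0) * (x 0 0 * sin (s 0 0) + - x 0 1 * cos (s 0 0))); first by ring.
by rewrite h1 h2 !mulr0 addr0.
Qed.

(** A common node of [x] and [y] would make both planar projections parallel to [C], against
    [X_indep]. *)
Lemma node_wgt_gt0 : 0 < teval (wgt x) s.
Proof.
rewrite teval_wgt big_seq_cond; apply: prodr_gt0 => y /andP[yX yx].
rewrite lt_def sqr_ge0 andbT sqrf_eq0.
apply: contra_neq (X_indep xX yX (_ : x != y)); last by rewrite eq_sym.
have cs := cos2Dsin2 (s 0 0); move: x_node => /= h1 h2.
rewrite -[LHS]mulr1 -cs.
transitivity ((x 0 0 * cos (s 0 0) + x 0 1 * sin (s 0 0)) *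
    - (y 0 0 * sin (s 0 0) + - y 0 1 * cos (s 0 0)) +
  (y 0 0 * cos (s 0 0) + y 0 1 * sin (s 0 0)) *
    (x 0 0 * sin (s 0 0) + - x 0 1 * cos (s 0 0))); first by ring.
by rewrite h1 h2 oppr0 !mulr0 addr0.
Qed.

Lemma node_beta : teval beta s = 0.
Proof. rewrite teval_beta; apply/eqP; rewrite prodf_seq_eq0; apply/hasP; exists x => //.
by rewrite x_node eqxx. Qed.

(** The weight of any other point contains the factor [det2 x] squared, which vanishes here. *)
Lemma node_sumX (F : 'rV[R]_m.+3 -> E) :
  \sum_(y <- X) teval (wgt y) s * teval (F y) s = teval (wgt x) s * teval (F x) s.
Proof.
rewrite (bigD1_seq x) //= big1 ?addr0 // => y yx.
have -> : teval (wgt y) s = 0; last by rewrite mul0r.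
rewrite teval_wgt; apply/eqP; rewrite prodf_seq_eq0; apply/hasP; exists x => //.
by rewrite eq_sym yx x_node expr0n eqxx.
Qed.

Lemma node_alpha : teval alpha s = teval (wgt x) s * teval (dot x) s.
Proof. by rewrite teval_sumX; exact: (node_sumX dot). Qed.

Lemma node_kappa : teval kappa s = teval (wgt x) s * teval (dot x) s ^+ 2.
Proof.
rewrite [LHS]/= teval_sumX node_beta mulr0 add0r expr2.
exact: (node_sumX (fun y => TMul (dot y) (dot y))).
Qed.

Lemma node_shear b : teval (shear b) s = teval (wgt x) s * teval (dot x) s * x 0 (rshift 2 b).
Proof.
rewrite teval_sumX -mulrA -(node_sumX (fun y => TMul (dot y) (TConst 1 (y 0 (rshift 2 b))))).
by apply: eq_bigr => y _ /=; rewrite mulrA.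
Qed.

End Node.

Lemma beta_eq0 s : teval beta s = 0 -> exists2 x, x \in X & teval (det2 x) s = 0.
Proof.
rewrite teval_beta => /eqP; rewrite prodf_seq_eq0 => /hasP[x xX /andP[_ /eqP h]].
by exists x.
Qed.

(** Away from all nodes the square of [beta] is positive; at a node the weighted sum takes over. *)
Lemma kappa_gt0 s : 0 < teval kappa s.
Proof.
have [/beta_eq0[x xX xs]|b0] := eqVneq (teval beta s) 0.
  rewrite (node_kappa xX xs) mulr_gt0 ?node_wgt_gt0 //.
  by rewrite lt_def sqr_ge0 sqrf_eq0 node_dot_neq0.
rewrite /= teval_sumX ltr_pwDl //; first by rewrite -expr2 lt_def sqr_ge0 sqrf_eq0 b0.
apply: sumr_ge0 => y _ /=; rewrite -expr2 mulr_ge0 ?sqr_ge0 // teval_wgt.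
by apply: prodr_ge0 => z _; exact: sqr_ge0.
Qed.

Lemma alpha_beta_gt0 s : 0 < teval alpha s ^+ 2 + teval beta s ^+ 2.
Proof.
have [/[dup] b0 /beta_eq0[x xX xs]|b0] := eqVneq (teval beta s) 0.
  rewrite b0 expr0n addr0 lt_def sqr_ge0 sqrf_eq0 (node_alpha xX xs) mulf_eq0.
  by rewrite negb_or node_dot_neq0 // gt_eqF // node_wgt_gt0.
by rewrite ltr_wpDl ?sqr_ge0 // lt_def sqr_ge0 sqrf_eq0 b0.
Qed.

(** A scaled rotation of the first two rows. At a node of [x] its upper left block is [alpha] times
    the identity, with the sign of [dot x], which differs at opposite nodes; [beta] lets it turn in
    between without becoming singular. *)
Let rotT : 'M[E]_(2 + m) := block_mx
  (\matrix_(i < 2, j < 2) if i == j then alpha else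
     if i == 0 then beta else TMul (TConst 1 (-1)) beta)
  (const_mx (TConst 1 0)) (const_mx (TConst 1 0))
  (\matrix_(i, j) TConst 1 (i == j)%:R).

Let circ (j : 'I_2) : E := if j == 0 then TCos 0 else TSin 0.

(** The first row is the radial vector [C]; the others are the remaining coordinate directions,
    sheared along [C] so as to be orthogonal to [x] at each node of [x]. *)
Let shearT : 'M[E]_(1 + m.+1, 2 + m.+1) := block_mx
  (\row_j circ j) (const_mx (TConst 1 0))
  (\matrix_(b, j) TMul (TConst 1 (-1)) (TMul (shear b) (circ j)))
  (\matrix_(b, b') TMul (TConst 1 (b == b')%:R) kappa).

Let ev p q (A : 'M[E]_(p, q)) s := map_mx (fun e => teval e s) A.

Definition circle_velocity s : 'rV[R]_m.+3 :=
  row_mx (\row_(j < 2) if j == 0 then - sin (s 0 0) else cos (s 0 0)) (0 : 'rV_m.+1).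

Let C s : 'rV[R]_2 := \row_j teval (circ j) s.
Let S s : 'cV[R]_m.+1 := \col_b teval (shear b) s.

Let evrot s : ev rotT s = block_mx
  (\matrix_(i < 2, j < 2) if i == j then teval alpha s else
     if i == 0 then teval beta s else - teval beta s) 0 0 1%:M.
Proof.
rewrite /ev map_block_mx; congr block_mx; apply/matrixP => i j; rewrite !mxE //.
by do 2 case: ifP => //= _; rewrite mulN1r.
Qed.

Let evshear s : ev shearT s = block_mx (C s) 0 (- (S s *m C s)) (teval kappa s)%:M.
Proof.
rewrite /ev map_block_mx; congr block_mx; apply/matrixP => i j; rewrite !mxE //.
  by rewrite big_ord1 !mxE /= mulN1r.
by rewrite [LHS]/= mulr_natl.
Qed.

(** The determinant is a product of [alpha^2 + beta^2], the determinant [-1] of the rows [C'] and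
    [C], and a power of [kappa]. *)
Lemma frame_det_lt0 s :
  \det (col_mx (circle_velocity s)
    ((ev rotT s : 'M[R]_m.+2) *m (ev shearT s : 'M[R]_(m.+2, m.+3))) : 'M[R]_m.+3) < 0.
Proof.
set g : 'rV[R]_2 := \row_(j < 2) if j == 0 then - sin (s 0 0) else cos (s 0 0).
have -> : (col_mx (circle_velocity s)
    ((ev rotT s : 'M[R]_m.+2) *m (ev shearT s : 'M[R]_(m.+2, m.+3))) : 'M[R]_m.+3) =
  (block_mx (1%:M : 'M[R]_1) 0 0 (ev rotT s : 'M[R]_m.+2) : 'M[R]_m.+3) *m
  (col_mx (circle_velocity s) (ev shearT s : 'M[R]_(m.+2, m.+3)) : 'M[R]_m.+3).
  by rewrite (@mul_block_col R 1 m.+2 1 m.+2 m.+3) mul1mx !mul0mx addr0 add0r.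
have -> : (col_mx (circle_velocity s) (ev shearT s : 'M[R]_(m.+2, m.+3)) : 'M[R]_m.+3) =
  (block_mx (col_mx g (C s) : 'M[R]_2) 0 (- (S s *m C s)) (teval kappa s)%:M : 'M[R]_(2 + m.+1)).
  rewrite evshear /circle_velocity /block_mx (@col_mxA R 1 1 m.+1).
  rewrite castmx_id -/(block_mx g 0 (C s) 0).
  by rewrite (block_mxEh g (0 : 'M[R]_(1, m.+1)) (C s) 0) col_mx0.
rewrite det_mulmx (@det_ublock R 1 m.+2) det1 mul1r (@det_lblock R 2 m.+1) det_scalar.
have row0 j : (col_mx g (C s) : 'M[R]_2) 0 j = g 0 j.
  have -> : (0 : 'I_2) = @lshift 1 1 0 by exact: val_inj.
  exact: (@col_mxEu R 1 1 2).
have row1 j : (col_mx g (C s) : 'M[R]_2) 1 j = C s 0 j.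
  have -> : (1 : 'I_2) = @rshift 1 1 0 by exact: val_inj.
  exact: (@col_mxEd R 1 1 2).
rewrite evrot (@det_ublock R 2 m) det1 mulr1 !det_mx2 !row0 !row1 !mxE /=.
set c := cos _; set d := sin _.
have -> : - d * d - c * c = -1 by rewrite -(cos2Dsin2 (s 0 0)) -/c -/d; ring.
rewrite mulN1r mulrN oppr_lt0 mulr_gt0 ?exprn_gt0 ?kappa_gt0 //.
have := alpha_beta_gt0 s; congr (0 < _); ring.
Qed.

Lemma dotv_circle_velocity s x : dotv x (circle_velocity s) = - teval (det2 x) s.
Proof.
rewrite /dotv /circle_velocity (@big_split_ord _ _ _ 2 m.+1) /= [X in _ + X]big1 ?addr0.
  rewrite big_ord_recl big_ord1 !(@row_mxEl R 1 2) !mxE /=.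
  have -> : lshift m.+1 (0 : 'I_2) = 0 :> 'I_m.+3 by exact: val_inj.
  have -> : lshift m.+1 (lift 0 0 : 'I_2) = 1 :> 'I_m.+3 by exact: val_inj.
  by ring.
by move=> i _; rewrite (@row_mxEr R 1 2) mxE mulr0.
Qed.

(** By [dotv_circle_velocity], [s] is a node of [x]. The shear sends [x] to [a] times the first
    basis vector, and the rotation multiplies this by [alpha = w a], so the sign of [a] cancels. *)
Lemma frame_node s x : x \in X -> dotv x (circle_velocity s) = 0 ->
  exists2 c, 0 < c &
    x *m ((ev rotT s : 'M[R]_m.+2) *m (ev shearT s : 'M[R]_(m.+2, m.+3)))^T =
      c *: delta_mx 0 0.
Proof.
move=> xX; rewrite dotv_circle_velocity => /eqP; rewrite oppr_eq0 => /eqP xs.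
set a := teval (dot x) s.
have a0 : a != 0 by exact: node_dot_neq0.
have xC : (lsubmx (x : 'rV_(2 + m.+1)) *m (C s)^T) = a%:M.
  apply/matrixP => i j; rewrite !ord1 !mxE big_ord_recl big_ord1 !mxE /=.
  have -> : lshift m.+1 (0 : 'I_2) = 0 :> 'I_m.+3 by exact: val_inj.
  by have -> : lshift m.+1 (lift 0 0 : 'I_2) = 1 :> 'I_m.+3 by exact: val_inj.
have xsh : x *m (ev shearT s : 'M[R]_(m.+2, m.+3))^T = a *: delta_mx 0 0.
  rewrite -[x](@hsubmxK R 1 2 m.+1) evshear (@tr_block_mx R 1 m.+1 2 m.+1).
  rewrite (@mul_row_block R 1 2 m.+1 1 m.+1) trmx0 mulmx0 addr0 xC.
  rewrite tr_scalar_mx linearN /= trmx_mul mulmxN mulmxA xC mul_scalar_mx mul_mx_scalar.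
  (* In each coordinate both terms are [w a^2 x_b] up to sign; [kappa] and [shear] are built for
     this. *)
  have -> : - (a *: (S s)^T) + teval kappa s *: rsubmx (x : 'rV_(2 + m.+1)) = 0.
    apply/rowP => b; rewrite !mxE (node_kappa xX xs) (node_shear xX xs) -/a.
    by ring.
  apply/rowP => j; case: (@split_ordP 1 m.+1 j) => {}j ->.
    by rewrite (@row_mxEl R 1 1) !mxE ord1 /= mulr1.
  by rewrite (@row_mxEr R 1 1) !mxE /= mulr0.
exists (a * teval alpha s).
  by rewrite (node_alpha xX xs) -/a mulrCA -expr2 mulr_gt0 ?node_wgt_gt0 //
    lt_def sqr_ge0 sqrf_eq0 a0.
rewrite trmx_mul mulmxA xsh -scalemxAl -scalerA -rowE; congr (_ *: _).
rewrite evrot; apply/rowP => j; rewrite [LHS]mxE [LHS]mxE [RHS]mxE [X in _ * X]mxE /=.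
have -> : (0 : 'I_m.+2) = lshift m (0 : 'I_2) by exact: val_inj.
case: (@split_ordP 2 m j) => {}j ->.
  apply: etrans (@block_mxEul R 2 m 2 m _ _ _ _ j 0) _.
  rewrite mxE (inj_eq (@lshift_inj 2 m)) (node_beta xX xs) oppr0.
  by case: (j == 0); rewrite ?mulr1 ?mulr0 //; case: ifP.
apply: etrans (@block_mxEdl R 2 m 2 m _ _ _ _ j 0) _.
by rewrite mxE; case: eqP => [/(congr1 val)//|_]; rewrite mulr0.
Qed.

Lemma exists_frame : exists A : 'I_m.+2 -> 'I_m.+3 -> texp 1,
  (forall s, \det (col_mx (circle_velocity s) (tmat A s) : 'M[R]_m.+3) < 0) /\
  forall s x, x \in X -> dotv x (circle_velocity s) = 0 ->
    exists2 c, 0 < c & x *m (tmat A s)^T = c *: delta_mx 0 0.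
Proof.
pose A i j : texp 1 := tsum (fun l : 'I_m.+2 =>
  TMul ((rotT : 'M[E]_m.+2) i l) ((shearT : 'M[E]_(m.+2, m.+3)) l j)).
have AE s : tmat A s = (ev rotT s : 'M[R]_m.+2) *m (ev shearT s : 'M[R]_(m.+2, m.+3)).
  apply/matrixP => i j; rewrite [LHS]mxE teval_sum [RHS]mxE.
  by apply: eq_bigr => l _; rewrite /ev [X in _ = X * _]mxE [X in _ = _ * X]mxE.
by exists A; split=> [s|s x]; rewrite AE; [exact: frame_det_lt0 | exact: frame_node].
Qed.

End Frame.

(** * Missing finitely many directions *)

Section Directions.
Context {R : realType}.

(** Each nonzero [v] is the coefficient vector of a nonzero polynomial. The product [p] of these has
    fewer than [size p] roots, so one of the first [size p] naturals is not a root. *)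
Lemma exists_moment_neq0 d (V : seq 'rV[R]_d) : (forall v, v \in V -> v != 0) ->
  exists t : R, forall v, v \in V -> \sum_i v 0 i * t ^+ i != 0.
Proof.
move=> V0; pose p := \prod_(v <- V) rVpoly v.
have p0 : p != 0.
  rewrite prodf_seq_neq0; apply/allP => v /V0; apply: contra => /eqP v0.
  by rewrite -(rVpolyK v) v0 linear0.
pose ts : seq R := [seq i%:R | i <- iota 0 (size p)].
have ts_uniq : uniq ts by rewrite map_inj_uniq ?iota_uniq // => i j /eqP; rewrite eqr_nat => /eqP.
have : ~~ all (root p) ts.
  apply/negP => /(max_poly_roots p0)/(_ ts_uniq).
  by rewrite size_map size_iota ltnn.
move=> /allPn[t _]; rewrite /root horner_prod prodf_seq_neq0 => /allP tV.
exists t => v /tV /=; rewrite (@horner_coef_wide _ d) ?size_poly //.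
rewrite (eq_bigr (fun i => v 0 i * t ^+ i)) // => i _.
by rewrite (coef_rVpoly_ord v i).
Qed.

(** The first functional [pt] is a moment functional nonzero on [X]. The minor of [x] and [y] is the
    second functional at [w x y], which is nonzero and lies in the kernel of [pt], so its tail is
    nonzero and a second moment functional, on tails, can be chosen. *)
Lemma exists_independent_projections m (X : seq 'rV[R]_m.+3) :
  (forall x, x \in X -> x != 0) ->
  (forall x y, x \in X -> y \in X -> x != y -> forall a b, a *: x = b *: y -> a = 0) ->
  exists M : 'M[R]_m.+3, [/\ \det M = 1,
    forall x, x \in X -> (x *m M) 0 0 != 0 &
    forall x y, x \in X -> y \in X -> x != y ->
      (x *m M) 0 0 * (y *m M) 0 1 - (x *m M) 0 1 * (y *m M) 0 0 != 0].
Proof.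
move=> X0 Xindep; have [t ht] := exists_moment_neq0 X0.
pose pt (x : 'rV[R]_m.+3) := \sum_i x 0 i * t ^+ i.
pose w (x y : 'rV[R]_m.+3) := pt x *: y - pt y *: x.
pose tail (v : 'rV[R]_m.+3) : 'rV[R]_m.+2 := \row_i v 0 (lift 0 i).
have ptw x y : pt (w x y) = 0.
  rewrite /pt /w; under eq_bigr do rewrite !mxE mulrBl -!mulrA.
  by rewrite sumrB -!mulr_sumr -/(pt x) -/(pt y) mulrC subrr.
pose V := [seq tail (w xy.1 xy.2) | xy <- [seq (x, y) | x <- X, y <- X] & xy.1 != xy.2].
have [v|u hu] := @exists_moment_neq0 _ V.
  move=> /mapP[[x y]]; rewrite mem_filter /= => /andP[xy /allpairsP[[x' y'] /= [xX yX [? ?]]]] ->.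
  subst x' y'; apply/eqP => tw.
  have wE i : w x y 0 (lift 0 i) = 0 by have /rowP/(_ i) := tw; rewrite !mxE.
  have w0 : w x y 0 0 = 0.
    have := ptw x y; rewrite /pt big_ord_recl big1 ?addr0 ?expr0 ?mulr1 // => i _.
    by rewrite wE mul0r.
  have : w x y = 0.
    apply/rowP => i; rewrite [RHS]mxE.
    by case: (unliftP 0 i) => [j ->|->]; [exact: wE | exact: w0].
  move=> /subr0_eq; rewrite eq_sym in xy.
  move=> /(Xindep y x yX xX xy) /eqP; apply/negP; exact: ht.
(* The two functionals are the first columns. Letting the second ignore coordinate 0 makes [M] lower
   triangular with unit diagonal. *)
pose M : 'M[R]_m.+3 := \matrix_(i, j)
  if j == 0 then t ^+ i else if j == 1 then (if i == 0 then 0 else u ^+ i.-1)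
  else (i == j)%:R.
have xM0 x : (x *m M) 0 0 = pt x.
  by rewrite mxE; apply: eq_bigr => i _; rewrite mxE eqxx.
have xM1 x : (x *m M) 0 1 = \sum_i tail x 0 i * u ^+ i.
  rewrite mxE big_ord_recl !mxE /= mulr0 add0r.
  by apply: eq_bigr => i _; rewrite !mxE.
exists M; split.
- rewrite det_trig; last first.
    apply/is_trig_mxP => i j ij; rewrite mxE.
    case: eqP => [j0|_]; first by move: ij; rewrite j0.
    case: eqP => [j1|_]; last by case: eqP => // ij'; move: ij; rewrite ij' ltnn.
    by case: eqP => // /eqP i0; move: ij i0; rewrite j1 -val_eqE /=; case: (val i).
  apply: big1 => i _; rewrite mxE eqxx.
  case: eqP => [->|/eqP i0]; first exact: expr0.
  by case: eqP => [->|_]; rewrite ?eqxx.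
- by move=> x xX; rewrite xM0; exact: ht.
move=> x y xX yX xy; rewrite !xM0 !xM1.
have wV : tail (w x y) \in V.
  apply/mapP; exists (x, y) => //; rewrite mem_filter xy /=.
  by apply/allpairsP; exists (x, y).
have := hu _ wV; congr (_ != 0); rewrite /w.
under eq_bigr do rewrite !mxE mulrBl -!mulrA.
rewrite sumrB -!mulr_sumr [X in _ = _ - X]mulrC; congr (_ * _ - _ * _).
  by apply: eq_bigr => i _; rewrite mxE.
by apply: eq_bigr => i _; rewrite mxE.
Qed.

(** The frame for the standard circle is built for the points [x *m M] and carried back by [M^T];
    scalar products against [x] then become those against [x *m M], and determinants are
    unchanged. *)
Lemma exists_off_rays m (X : seq 'rV[R]_m.+3) (h : 'I_m.+2 -> @texp R m.+1) :
  uniq X -> (forall x, x \in X -> x != 0) ->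
  (forall x y, x \in X -> y \in X -> x != y -> forall a b, a *: x = b *: y -> a = 0) ->
  (forall t, off_ray (delta_mx 0 0) (nu (tjac h t))) ->
  exists f : 'I_m.+3 -> @texp R m.+2, forall t x, x \in X -> off_ray x (nu (tjac f t)).
Proof.
move=> Xuniq X0 Xindep hoff.
have [M [detM M0 Mindep]] := exists_independent_projections X0 Xindep.
have Minj : injective (fun x : 'rV[R]_m.+3 => x *m M).
  apply: (can_inj (g := fun x => x *m invmx M)) => x.
  by rewrite mulmxK // unitmxE detM unitr1.
pose X' := [seq x *m M | x <- X].
have X'uniq : uniq X' by rewrite map_inj_uniq.
have [||A [detA nodeA]] := @exists_frame R m X' X'uniq.
- by move=> _ /mapP[x xX ->]; exact: M0.
- move=> _ _ /mapP[x xX ->] /mapP[y yX ->] xy; apply: Mindep => //.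
  by apply: contra xy => /eqP ->.
pose gam j : @texp R 1 :=
  TAdd (TMul (TConst 1 (M j 0)) (TCos 0)) (TMul (TConst 1 (M j 1)) (TSin 0)).
pose AM l j : @texp R 1 := tsum (fun i => TMul (A l i) (TConst 1 (M j i))).
have gamE s : tjac gam s = circle_velocity s *m M^T.
  apply/matrixP => i j; rewrite ord1 !mxE /= (@big_split_ord _ _ _ 2 m.+1) /=.
  rewrite [X in _ = _ + X]big1 ?addr0 => [|l _]; last first.
    by rewrite (@row_mxEr R 1 2) mxE mul0r.
  rewrite big_ord_recl big_ord1 !(@row_mxEl R 1 2) !mxE /=.
  have -> : lshift m.+1 (0 : 'I_2) = 0 :> 'I_m.+3 by exact: val_inj.
  have -> : lshift m.+1 (lift 0 0 : 'I_2) = 1 :> 'I_m.+3 by exact: val_inj.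
  by ring.
have AME s : tmat AM s = tmat A s *m M^T.
  apply/matrixP => i j; rewrite [LHS]mxE teval_sum [RHS]mxE.
  by apply: eq_bigr => l _; rewrite !mxE.
apply: (@tube_off_rays R m.+1 h gam AM) => // [s|s x xX].
  rewrite gamE AME.
  have -> : (col_mx (circle_velocity s *m M^T) (tmat A s *m M^T) : 'M[R]_m.+3) =
      (col_mx (circle_velocity s) (tmat A s) : 'M[R]_m.+3) *m M^T.
    exact: esym (@mul_col_mx R 1 m.+2 m.+3 m.+3 _ _ _).
  by rewrite det_mulmx det_tr detM mulr1.
rewrite gamE AME dotv_mulmx trmxK => /(nodeA _ _ (map_f _ xX))[c c0 xA].
by exists c => //; rewrite trmx_mul trmxK mulmxA.
Qed.

(** * The figure eight and induction on the dimension *)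

Definition figure_eight (j : 'I_2) : @texp R 1 :=
  if j == 0 then TSin 0 else TMul (TSin 0) (TCos 0).

(** Here [nu] is [(cos 2t, - cos t)]: where the second coordinate vanishes, the first is [-1]. *)
Lemma figure_eight_off_ray t : off_ray (delta_mx 0 0) (nu (tjac figure_eight t)).
Proof.
have l0 : lift (0 : 'I_2) 0 = 1 by exact: val_inj.
have l1 : lift (1 : 'I_2) 0 = 0 by exact: val_inj.
have [c0|c0] := eqVneq (cos (t 0 0)) 0.
  left; rewrite dotv_delta nuE det_mx11 !mxE l0 /= c0.
  have := cos2Dsin2 (t 0 0); rewrite c0 expr0n add0r /= => s2.
  by rewrite expr0 !mul1r !mulr0 add0r mulN1r mulrN -expr2 s2; lra.
right; exists 1, 0; rewrite !nuE !det_mx11 !mxE l0 l1 /= expr1.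
rewrite !mulr1 !mulr0 mulN1r oppr_eq0 mul1r; exact: c0.
Qed.

(** Each step is a tube that has to miss only the first basis vector, so the independence condition
    is vacuous. *)
Lemma exists_off_ray m : exists h : 'I_m.+2 -> @texp R m.+1,
  forall t, off_ray (delta_mx 0 0) (nu (tjac h t)).
Proof.
elim: m => [|m [h hoff]]; first by exists figure_eight; exact: figure_eight_off_ray.
have e0 : (delta_mx 0 0 : 'rV[R]_m.+3) != 0.
  by apply/eqP => /matrixP/(_ 0 0); rewrite !mxE => /eqP; rewrite oner_eq0.
have [||f hf] := @exists_off_rays m [:: delta_mx 0 0] h isT _ _ hoff.
- by move=> x; rewrite inE => /eqP ->.
- by move=> x y; rewrite !inE => /eqP -> /eqP ->; rewrite eqxx.
by exists f => t; apply: hf; rewrite inE.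
Qed.

End Directions.

Theorem mainTheorem2 (R : realType) (n : nat) (hn : (2 <= n)%N)
    (X : set 'rV[R]_n.+1) (X_sphere : X `<=` sphere R n) (X_fin : finite_set X)
    (X_antipodal : forall x, X x -> ~ X (- x)) :
  exists (N : orientedManifold R n) (F G : N -> 'rV[R]_n.+1),
    [/\ [set: N] !=set0, compact [set: N], immersion F, is_gauss_map F G &
        range G `&` X = set0].
Proof.
case: n hn X X_sphere X_fin X_antipodal => [|[|m]] // _ X X_sphere X_fin X_antipodal.
have /finite_seqP[s Xs] := X_fin.
have sX x : (x \in undup s) = (x \in s) := mem_undup s x.
have Xx x : x \in s -> X x by rewrite Xs.
have X0 x : X x -> x != 0.
  by move=> /X_sphere xx; rewrite -dotv_gt0 xx ltr01.
have e0 : (delta_mx 0 0 : 'rV[R]_m.+3) != 0.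
  by apply/eqP => /matrixP/(_ 0 0); rewrite !mxE => /eqP; rewrite oner_eq0.
(* Comparing lengths of [a *: x = b *: y] gives [a = b] or [a = - b]; for nonzero [a] this means
   [x = y] or [x = - y]. *)
have s_indep x y : x \in s -> y \in s -> x != y -> forall a b, a *: x = b *: y -> a = 0.
  move=> /Xx xX /Xx yX xy a b axby; apply/eqP; apply: contraNT xy => a0.
  have x1 : dotv x x = 1 := X_sphere _ xX.
  have y1 : dotv y y = 1 := X_sphere _ yX.
  have : dotv (a *: x) (a *: x) = dotv (b *: y) (b *: y) by rewrite axby.
  rewrite !dotvZl ![dotv _ (_ *: _)]dotvC !dotvZl x1 y1 !mulr1 -!expr2 => /eqP.
  rewrite eqf_sqr => /orP[/eqP ab|/eqP ab].
    by move: axby; rewrite -ab => /(scalerI a0) ->.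
  have xNy : x = - y.
    by apply: (scalerI a0); rewrite axby ab scaleNr scalerN opprK.
  by have := X_antipodal _ yX; rewrite -xNy => /(_ xX).
have [h hoff] := @exists_off_ray R m.
(* The extra missed direction [x0] ensures that [nu] never vanishes, also when [X] is empty. *)
have [x0 [e [x00 e0off eoff]]] : exists (x0 : 'rV[R]_m.+3) e, [/\ x0 != 0,
    forall t, off_ray x0 (nu (tjac e t)) & forall t x, X x -> off_ray x (nu (tjac e t))].
  have [s0|[x0 x0s]] : s = [::] \/ exists x0, x0 \in s.
  - by case: (s) => [|x0 s']; [left | right; exists x0; rewrite mem_head].
  - have [f hf] := @exists_off_ray R m.+1.
    by exists (delta_mx 0 0), f; split=> // t x; rewrite Xs s0 /= in_nil.
  have [||f hf] := @exists_off_rays R m (undup s) h (undup_uniq s) _ _ hoff.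
  - by move=> x; rewrite sX => /Xx /X0.
  - by move=> x y; rewrite !sX; exact: s_indep.
  exists x0, f; split=> [|t|t x]; first exact: X0 (Xx _ x0s).
    by apply: hf; rewrite sX.
  by rewrite Xs /= => xs; apply: hf; rewrite sX.
apply: (@torus_gauss_map R m.+2 X e) => // t.
by have /(off_rayP _ x00)/(_ 0 (lexx _)) := e0off t; rewrite scale0r.
Qed.
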